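(* Assume the Axiom of Choice. Let $A$ be a $\boldsymbol{\mathit{ba}\ell}$-algebra, $X$ the set of proper archimedean $\ell$-ideals with the Alexandroff topology, $Y_A\subseteq X$ the set of maximal $\ell$-ideals, $\varphi:D(\mathbb R[B])\to N(X)$ the isomorphism with $\varphi(x_I)=\chi_{U_I}$, $\psi:N(X)\to B(Y_A)$ the restriction isomorphism, and $\gamma=\varphi\circ\alpha:A\to N(X)$. Then $D(\mathbb R[B])$, $N(X)$ and $B(Y_A)$ are isomorphic; $\psi\circ\varphi$ sends $x_I$ to the characteristic function of $\{M\in Y_A\mid I\not\subseteq M\}$ for each $I\in{\sf Arch}(A)$; $\psi\circ\gamma=\zeta_A$; and for all $a\in A$ and $I\in X$, $$\gamma(a)(I)=\sup\{r\in\mathbb R\mid (a-r)^-\in I\}.$$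
   Context: A $\boldsymbol{\mathit{ba}\ell}$-algebra is a commutative unital lattice-ordered algebra $A$ over $\mathbb R$ that is bounded (for every $a\in A$ there is an integer $n\ge1$ with $a\le n\cdot1$) and archimedean (if $na\le b$ for all $n\ge1$ then $a\le0$); reals $r$ are identified with $r\cdot1$. $a^-=(-a)\vee0$. An $\ell$-ideal is a ring ideal $I$ with $|a|\le|b|$, $b\in I\Rightarrow a\in I$; it is archimedean if $A/I$ is archimedean. ${\sf Arch}(A)$ is the frame of archimedean $\ell$-ideals ordered by inclusion, with join $I\vee J$ the least archimedean $\ell$-ideal containing $I\cup J$; $U_I=\{J\in X\mid J\vee I=A\}$. $B$ is the free boolean extension of ${\sf Arch}(A)$, ${\sf Arch}(A)\subseteq B$, $\lnot$ its complement. $\mathbb R[B]$ is the quotient of $\mathbb R[x_e\mid e\in B]$ by the ideal generated by $x_{e\wedge f}-x_ex_f$, $x_{e\vee f}-(x_e+x_f-x_ex_f)$, $x_{\lnot e}-(1-x_e)$, $x_0$; $D(\mathbb R[B])$ its Dedekind completion. $\alpha:A\to D(\mathbb R[B])$ is $\alpha(a)=-s+\bigvee\{rx_{\lnot I}\mid r\in\mathbb R,\ I\in{\sf Arch}(A),\ (a+s-r)^-\in I\}$ for any $s$ with $a+s\ge0$. For a space $X$, $B(X)$ is bounded real functions, $f_*(x)=\sup\{\inf f[U]\mid U\text{ open}\ni x\}$, $f^*(x)=\inf\{\sup f[U]\mid U\text{ open}\ni x\}$, $N(X)=\{f\mid f=(f^* )_*\}$ with operations the normalizations of pointwise ones. The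 Alexandroff topology has upsets as opens. $\zeta_A:A\to B(Y_A)$ is $\zeta_A(a)(M)=$ the unique $r\in\mathbb R$ with $a+M=r+M$. *)

(* Defs.v *)
From Stdlib Require Import Reals Classical ClassicalDescription Epsilon.
From Coquelicot Require Import Coquelicot.
Open Scope R_scope.

Record ralg := {
  rcar :> Type;
  radd : rcar -> rcar -> rcar;
  rmul : rcar -> rcar -> rcar;
  ropp : rcar -> rcar;
  rzero : rcar;
  rone : rcar;
  rscal : R -> rcar -> rcar;
  raddA : forall a b c, radd a (radd b c) = radd (radd a b) c;
  raddC : forall a b, radd a b = radd b a;
  radd0 : forall a, radd a rzero = a;
  raddN : forall a, radd a (ropp a) = rzero;
  rmulA : forall a b c, rmul a (rmul b c) = rmul (rmul a b) c;
  rmulC : forall a b, rmul a b = rmul b a;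
  rmul1 : forall a, rmul a rone = a;
  rmulDl : forall a b c, rmul (radd a b) c = radd (rmul a c) (rmul b c);
  rscalA : forall r s a, rscal r (rscal s a) = rscal (r * s) a;
  rscal1 : forall a, rscal 1 a = a;
  rscalDr : forall r a b, rscal r (radd a b) = radd (rscal r a) (rscal r b);
  rscalDl : forall r s a, rscal (r + s) a = radd (rscal r a) (rscal s a);
  rscalMl : forall r a b, rscal r (rmul a b) = rmul (rscal r a) b
}.

Arguments radd {_}. Arguments rmul {_}. Arguments ropp {_}.
Arguments rzero {_}. Arguments rone {_}. Arguments rscal {_}.

Definition rsub {T : ralg} (a b : T) := radd a (ropp b).
Definition rcst {T : ralg} (r : R) : T := rscal r rone.

Definition alg_hom {S T : ralg} (h : S -> T) : Prop :=
  (forall a b, h (radd a b) = radd (h a) (h b)) /\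
  (forall a b, h (rmul a b) = rmul (h a) (h b)) /\
  (forall r a, h (rscal r a) = rscal r (h a)) /\
  h rone = rone.

Record ballg := {
  bal :> ralg;
  ble : bal -> bal -> Prop;
  bjoin : bal -> bal -> bal;
  bmeet : bal -> bal -> bal;
  ble_refl : forall a, ble a a;
  ble_trans : forall a b c, ble a b -> ble b c -> ble a c;
  ble_anti : forall a b, ble a b -> ble b a -> a = b;
  bjoin_l : forall a b, ble a (bjoin a b);
  bjoin_r : forall a b, ble b (bjoin a b);
  bjoin_lub : forall a b c, ble a c -> ble b c -> ble (bjoin a b) c;
  bmeet_l : forall a b, ble (bmeet a b) a;
  bmeet_r : forall a b, ble (bmeet a b) b;
  bmeet_glb : forall a b c, ble c a -> ble c b -> ble c (bmeet a b);
  ble_add : forall a b c, ble a b -> ble (radd a c) (radd b c);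
  ble_scal : forall r a, 0 <= r -> ble rzero a -> ble rzero (rscal r a);
  ble_mul : forall a b, ble rzero a -> ble rzero b -> ble rzero (rmul a b);
  bbounded : forall a, exists n : nat, (1 <= n)%nat /\ ble a (rcst (INR n));
  barchimedean : forall a b,
      (forall n : nat, (1 <= n)%nat -> ble (rscal (INR n) a) b) -> ble a rzero
}.

Arguments ble {_}. Arguments bjoin {_}. Arguments bmeet {_}.

Section Ideals.
Variable A : ballg.

Definition babs (a : A) : A := bjoin a (ropp a).
Definition bpos (a : A) : A := bjoin a rzero.
Definition bneg (a : A) : A := bjoin (ropp a) rzero.

Definition lideal (I : A -> Prop) : Prop :=
  I rzero /\
  (forall a b, I a -> I b -> I (radd a b)) /\
  (forall a b, I b -> I (rmul a b)) /\
  (forall a b, ble (babs a) (babs b) -> I b -> I a).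

(* A/I archimedean, with the quotient order unfolded:
   a + I <= b + I  iff  (a - b)^+ \in I. *)
Definition arch_lideal (I : A -> Prop) : Prop :=
  lideal I /\
  forall a b : A,
    (forall n : nat, (1 <= n)%nat -> I (bpos (rsub (rscal (INR n) a) b))) ->
    I (bpos a).

Definition proper (I : A -> Prop) : Prop := exists a, ~ I a.

Definition maximal_lideal (M : A -> Prop) : Prop :=
  lideal M /\ proper M /\
  forall J, lideal J -> (forall a, M a -> J a) -> (forall a, J a -> M a) \/ (forall a, J a).

Definition archjoin (I J : A -> Prop) : A -> Prop :=
  fun a => forall K, arch_lideal K -> (forall b, I b -> K b) -> (forall b, J b -> K b) -> K a.

Definition Arch := { I : A -> Prop | arch_lideal I }.
Definition Xsp := { I : A -> Prop | arch_lideal I /\ proper I }.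
Definition Ysp := { M : A -> Prop | maximal_lideal M }.

Definition U_ (I : Arch) (J : Xsp) : Prop :=
  forall a, archjoin (proj1_sig J) (proj1_sig I) a.

(* Alexandroff topology on X: opens are the upsets for inclusion *)
Definition openX (U : Xsp -> Prop) : Prop :=
  forall I J : Xsp, U I -> (forall a, proj1_sig I a -> proj1_sig J a) -> U J.

(* zeta_A(a)(M) = the unique r with a + M = r + M *)
Definition zetaA (a : A) (M : Ysp) : R :=
  epsilon (inhabits 0) (fun r => proj1_sig M (rsub a (rcst r))).

End Ideals.

Arguments lideal {A}. Arguments arch_lideal {A}. Arguments proper {A}.
Arguments maximal_lideal {A}. Arguments archjoin {A}. Arguments U_ {A}.
Arguments openX {A}. Arguments zetaA {A}. Arguments bneg {A}.

Section Normal.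
Variable T : Type.
Variable opn : (T -> Prop) -> Prop.

Definition bdd (f : T -> R) : Prop := exists c, forall x, Rabs (f x) <= c.

Definition Rinf (S : R -> Prop) : R := real (Glb_Rbar S).
Definition Rsup (S : R -> Prop) : R := real (Lub_Rbar S).

Definition lower (f : T -> R) (x : T) : R :=
  Rsup (fun y => exists U, opn U /\ U x /\ y = Rinf (fun z => exists u, U u /\ z = f u)).
Definition upper (f : T -> R) (x : T) : R :=
  Rinf (fun y => exists U, opn U /\ U x /\ y = Rsup (fun z => exists u, U u /\ z = f u)).

Definition isN (f : T -> R) : Prop := bdd f /\ f = lower (upper f).
Definition normz (f : T -> R) : T -> R := lower (upper f).

End Normal.

Definition chi {T : Type} (P : T -> Prop) (x : T) : R :=
  if excluded_middle_informative (P x) then 1 else 0.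

Record boolalg := {
  bcar :> Type;
  bm : bcar -> bcar -> bcar;
  bj : bcar -> bcar -> bcar;
  bc : bcar -> bcar;
  b0 : bcar;
  b1 : bcar;
  bmA : forall a b c, bm a (bm b c) = bm (bm a b) c;
  bjA : forall a b c, bj a (bj b c) = bj (bj a b) c;
  bmC : forall a b, bm a b = bm b a;
  bjC : forall a b, bj a b = bj b a;
  bmabs : forall a b, bm a (bj a b) = a;
  bjabs : forall a b, bj a (bm a b) = a;
  bdistr : forall a b c, bm a (bj b c) = bj (bm a b) (bm a c);
  bj0 : forall a, bj a b0 = a;
  bm1 : forall a, bm a b1 = a;
  bjc : forall a, bj a (bc a) = b1;
  bmc : forall a, bm a (bc a) = b0
}.
Arguments bm {_}. Arguments bj {_}. Arguments bc {_}. Arguments b0 {_}. Arguments b1 {_}.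

(* e : Arch(A) -> B exhibits B as the free boolean extension of the
   bounded distributive lattice Arch(A): e is an injective bounded
   lattice homomorphism whose image generates B as a boolean algebra. *)
Definition free_bool_ext {A : ballg} {B : boolalg} (e : Arch A -> B) : Prop :=
  (forall I J, e I = e J -> I = J) /\
  (forall I J K : Arch A, (forall a, proj1_sig K a <-> proj1_sig I a /\ proj1_sig J a) ->
      e K = bm (e I) (e J)) /\
  (forall I J K : Arch A, (forall a, proj1_sig K a <-> archjoin (proj1_sig I) (proj1_sig J) a) ->
      e K = bj (e I) (e J)) /\
  (forall K : Arch A, (forall a, proj1_sig K a <-> a = rzero) -> e K = b0) /\
  (forall K : Arch A, (forall a, proj1_sig K a) -> e K = b1) /\
  (forall S : B -> Prop, (forall I, S (e I)) -> S b0 -> S b1 ->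
      (forall u v, S u -> S v -> S (bm u v)) ->
      (forall u v, S u -> S v -> S (bj u v)) ->
      (forall u, S u -> S (bc u)) -> forall u, S u).

(* R[B]: quotient of R[x_e | e in B] by the stated relations, given by *)
(* its universal property.                                             *)
Definition RB_rel {B : boolalg} {T : ralg} (y : B -> T) : Prop :=
  (forall e f, y (bm e f) = rmul (y e) (y f)) /\
  (forall e f, y (bj e f) = rsub (radd (y e) (y f)) (rmul (y e) (y f))) /\
  (forall e, y (bc e) = rsub rone (y e)) /\
  y b0 = rzero.

Definition is_RB {B : boolalg} {RB : ralg} (x : B -> RB) : Prop :=
  RB_rel x /\
  forall (T : ralg) (y : B -> T), RB_rel y ->
    exists! h : RB -> T, alg_hom h /\ forall e, h (x e) = y e.

(* Dedekind completion: j embeds R[B] as a join-dense l-subalgebra of  *)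
(* the Dedekind complete ba-l-algebra D (order on R[B] induced by j).  *)
Definition is_lubD {D : ballg} (S : D -> Prop) (l : D) : Prop :=
  (forall d, S d -> ble d l) /\ (forall u, (forall d, S d -> ble d u) -> ble l u).

Definition dedekind_completion {RB : ralg} {D : ballg} (j : RB -> D) : Prop :=
  alg_hom (T := bal D) j /\
  (forall r s, j r = j s -> r = s) /\
  (forall r s, exists t, j t = bjoin (j r) (j s)) /\
  (forall r s, exists t, j t = bmeet (j r) (j s)) /\
  (forall S : D -> Prop, (exists d, S d) -> (exists u, forall d, S d -> ble d u) ->
      exists l, is_lubD S l) /\
  (forall d : D, is_lubD (fun y => exists r, y = j r /\ ble (j r) d) d).

(* alpha(a) = -s + \/ { r x_{~I} | (a + s - r)^- in I }, for s with a + s >= 0 *)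
Definition alpha_rel {A D : ballg} {B : boolalg} {RB : ralg}
  (e : Arch A -> B) (x : B -> RB) (j : RB -> D) (a : A) (d : D) : Prop :=
  exists s : R, ble rzero (radd a (rcst s)) /\
    is_lubD (fun y => exists (r : R) (I : Arch A),
                 proj1_sig I (bneg (rsub (radd a (rcst s)) (rcst r))) /\
                 y = j (rscal r (x (bc (e I)))))
            (radd d (rcst s)).

(* phi : D -> N(X) is an isomorphism of ba-l-algebras, where N(X) carries
   the normalized pointwise operations and the pointwise order *)
Definition iso_DN {A D : ballg} (phi : D -> Xsp A -> R) : Prop :=
  let N := isN (Xsp A) (@openX A) in
  let nz := normz (Xsp A) (@openX A) in
  (forall d, N (phi d)) /\
  (forall f, N f -> exists d, phi d = f) /\
  (forall d1 d2, phi d1 = phi d2 -> d1 = d2) /\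
  (forall d1 d2, phi (radd d1 d2) = nz (fun I => phi d1 I + phi d2 I)) /\
  (forall d1 d2, phi (rmul d1 d2) = nz (fun I => phi d1 I * phi d2 I)) /\
  (forall r d, phi (rscal r d) = nz (fun I => r * phi d I)) /\
  phi rone = (fun _ => 1) /\
  (forall d1 d2, ble d1 d2 <-> forall I, phi d1 I <= phi d2 I).

Definition iso_NB {A : ballg} (psi : (Xsp A -> R) -> (Ysp A -> R)) : Prop :=
  let N := isN (Xsp A) (@openX A) in
  let nz := normz (Xsp A) (@openX A) in
  (forall f, N f -> bdd (Ysp A) (psi f)) /\
  (forall g, bdd (Ysp A) g -> exists f, N f /\ psi f = g) /\
  (forall f g, N f -> N g -> psi f = psi g -> f = g) /\
  (forall f g, N f -> N g -> psi (nz (fun I => f I + g I)) = (fun M => psi f M + psi g M)) /\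
  (forall f g, N f -> N g -> psi (nz (fun I => f I * g I)) = (fun M => psi f M * psi g M)) /\
  (forall r f, N f -> psi (nz (fun I => r * f I)) = (fun M => r * psi f M)) /\
  psi (fun _ => 1) = (fun _ => 1) /\
  (forall f g, N f -> N g -> ((forall I, f I <= g I) <-> forall M, psi f M <= psi g M)).

(* Main.v *)
(** Evaluation at a maximal l-ideal [M] is a homomorphism [A -> R], and by Zorn's lemma every
    archimedean l-ideal is an intersection of maximal ones. Hence inequalities in any
    ba-l-algebra can be tested at its maximal l-ideals, and a normal function on [X] is
    determined by its restriction to [Y_A], which can be any bounded function: the value at a
    point is the infimum over the maximal ideals above it. Each [M] in [Y_A] induces an ultrafilter on [B], hence a
    homomorphism [tau M : R[B] -> R], and these jointly reflect the order. As [M] is itself an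
    element of Arch(A), the element [x_{~M}] is an atom of [R[B]]; multiplying by it reads off
    the [M]-coordinate of any element of the completion, which identifies [D(R[B])] with
    [B(Y_A)]. Under this identification the supremum defining [alpha(a)] has [M]-coordinate
    [zeta_A(a)(M)]. *)

(* The order on [RB] is known only through [j], so positivity of an element of [RB] has to be
   derived inside [D]. It rests on each [j (x b)] being idempotent, hence nonnegative, and on every
   element of [RB] being a finite real combination of the [x (e I)], which can be cut into cells
   where it is constant.

   The maximal l-ideals of [D] are not assumed to come from those of [A]. Two kinds of evaluation
   therefore coexist on [D]: [zetaA] at the maximal l-ideals of [D] verifies identities and
   inequalities, while [coeff], indexed by the maximal l-ideals of [A], gives the coordinates that
   identify [D] with bounded functions.

   The theorem speaks of every isomorphism [phi] with the prescribed values, not of a chosen one.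
   [coeff] serves to build one such [phi]; the claims on [alpha] and [gamma] are then derived from
   the stated properties of an arbitrary [phi]. The formula for [gamma] is spatiality again:
   [(a - r)^-] lies in [J] exactly when [a] has value at least [r] at every maximal l-ideal above
   [J]. *)
Require Import Defs.
From Stdlib Require Import Reals Lra Classical ClassicalDescription Epsilon.
From Stdlib Require Import FunctionalExtensionality PropExtensionality ProofIrrelevance.
From Coquelicot Require Import Coquelicot.
From mathcomp Require classical_sets.
Open Scope R_scope.

(** * Arithmetic and l-ideals of ba-l-algebras *)

Declare Scope ralg_scope.
Delimit Scope ralg_scope with A.
Local Notation "0" := rzero : ralg_scope.
Local Notation "1" := rone : ralg_scope.
Local Notation "a + b" := (radd a b) : ralg_scope.
Local Notation "a - b" := (rsub a b) : ralg_scope.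
Local Notation "- a" := (ropp a) : ralg_scope.
Local Notation "a * b" := (rmul a b) : ralg_scope.
Local Notation "a <= b" := (ble a b) : ralg_scope.

Section RalgTheory.
Variable T : ralg.
Implicit Types a b c : T.

Lemma ralg_ring : ring_theory (@rzero T) rone radd rmul rsub ropp eq.
Proof.
  constructor; intros.
  - rewrite raddC; apply radd0.
  - apply raddC.
  - apply raddA.
  - rewrite rmulC; apply rmul1.
  - apply rmulC.
  - apply rmulA.
  - apply rmulDl.
  - reflexivity.
  - apply raddN.
Qed.

Add Ring ralg_ring : ralg_ring.

Lemma rscalE r a : rscal r a = (rcst r * a)%A.
Proof. unfold rcst. rewrite <- rscalMl. f_equal. ring. Qed.

Lemma rcstD r s : @rcst T (r + s) = (rcst r + rcst s)%A.
Proof. apply rscalDl. Qed.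

Lemma rcstM r s : @rcst T (r * s) = (rcst r * rcst s)%A.
Proof. rewrite <- rscalE. unfold rcst. now rewrite rscalA. Qed.

Lemma rcst1 : @rcst T 1 = 1%A.
Proof. apply rscal1. Qed.

Lemma rcst0 : @rcst T 0 = 0%A.
Proof.
  assert (H : (@rcst T 0 + rcst 0 = rcst 0)%A) by (rewrite <- rcstD; f_equal; lra).
  transitivity ((@rcst T 0 + rcst 0) - rcst 0)%A; [ring | rewrite H; ring].
Qed.

Lemma rcstN r : @rcst T (- r) = (- rcst r)%A.
Proof.
  assert (H : (@rcst T (- r) + rcst r = 0)%A)
    by (rewrite <- rcstD, <- rcst0; f_equal; lra).
  transitivity ((@rcst T (- r) + rcst r) - rcst r)%A; [ring | rewrite H; ring].
Qed.

Lemma rcstB r s : @rcst T (r - s) = (rcst r - rcst s)%A.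
Proof. unfold Rminus. rewrite rcstD, rcstN. ring. Qed.

Lemma roppE a : (- a)%A = rscal (-1) a.
Proof. rewrite rscalE. replace (-1) with (- (1)) by lra. rewrite rcstN, rcst1. ring. Qed.

End RalgTheory.

Section AlgHom.
Variables (S T : ralg) (h : S -> T).
Hypothesis Hh : alg_hom h.

Add Ring S_ring : (ralg_ring S).
Add Ring T_ring : (ralg_ring T).

Lemma homD a b : h (a + b)%A = (h a + h b)%A. Proof. apply Hh. Qed.
Lemma homM a b : h (a * b)%A = (h a * h b)%A. Proof. apply Hh. Qed.
Lemma homZ r a : h (rscal r a) = rscal r (h a). Proof. apply Hh. Qed.
Lemma hom1 : h 1%A = 1%A. Proof. apply Hh. Qed.
Lemma homC r : h (rcst r) = rcst r.
Proof. unfold rcst. now rewrite homZ, hom1. Qed.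
Lemma hom0 : h 0%A = 0%A.
Proof. rewrite <- !rcst0. apply homC. Qed.
Lemma homN a : h (- a)%A = (- h a)%A.
Proof. now rewrite !roppE, homZ. Qed.
Lemma homB a b : h (a - b)%A = (h a - h b)%A.
Proof. unfold rsub. now rewrite homD, homN. Qed.

End AlgHom.

Section BallgTheory.
Variable A : ballg.
Implicit Types a b c t u v : A.
Implicit Types I J K M : A -> Prop.

Add Ring A_ring : (ralg_ring A).

Lemma sub_ge0 a b : (a <= b)%A -> (0 <= b - a)%A.
Proof.
  intros H. replace 0%A with (a + - a)%A by ring. unfold rsub. now apply ble_add.
Qed.

Lemma le_of_sub a b : (0 <= b - a)%A -> (a <= b)%A.
Proof.
  intros H. replace a with (0 + a)%A by ring. replace b with ((b - a) + a)%A by ring.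
  now apply ble_add.
Qed.

Lemma ble_add2 a b c t : (a <= b -> c <= t -> a + c <= b + t)%A.
Proof.
  intros H1 H2. apply ble_trans with (b + c)%A; [now apply ble_add|].
  rewrite (raddC A b c), (raddC A b t). now apply ble_add.
Qed.

Lemma add_ge0 a b : (0 <= a -> 0 <= b -> 0 <= a + b)%A.
Proof. intros. replace (@rzero A) with (0 + 0 : A)%A by ring. now apply ble_add2. Qed.

(** Positivity of the unit comes from boundedness: some [n >= 1] satisfies [0 <= n * 1], and scaling
    by [1 / n] is monotone. *)
Lemma one_ge0 : (@ble A 0 1)%A.
Proof.
  destruct (bbounded A 0%A) as [n [Hn H]].
  assert (Hp : 0 < INR n) by exact (lt_0_INR n Hn).
  assert (H1 := ble_scal A (/ INR n) _ (Rlt_le _ _ (Rinv_0_lt_compat _ Hp)) H).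
  unfold rcst in H1. rewrite rscalA, Rinv_l, rscal1 in H1; [exact H1 | lra].
Qed.

Lemma rcst_ge0 r : 0 <= r -> (@ble A 0 (rcst r))%A.
Proof. intros. apply ble_scal; [assumption | apply one_ge0]. Qed.

Lemma rcst_le r s : r <= s -> (@ble A (rcst r) (rcst s))%A.
Proof. intros. apply le_of_sub. rewrite <- rcstB. apply rcst_ge0. lra. Qed.

Lemma scal_le r a b : 0 <= r -> (a <= b)%A -> (rcst r * a <= rcst r * b)%A.
Proof.
  intros Hr H. apply le_of_sub. replace (rcst r * b - rcst r * a)%A with (rcst r * (b - a))%A by ring.
  apply ble_mul; [now apply rcst_ge0 | now apply sub_ge0].
Qed.

Lemma scal_cancel r a : 0 < r -> (0 <= rcst r * a)%A -> (0 <= a)%A.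
Proof.
  intros Hr H.
  replace a with (rcst (/ r) * (rcst r * a))%A.
  - apply ble_mul; auto. apply rcst_ge0. now apply Rlt_le, Rinv_0_lt_compat.
  - replace (rcst (/ r) * (rcst r * a))%A with (rcst (/ r) * rcst r * a)%A by ring.
    rewrite <- rcstM, Rinv_l, rcst1 by lra. ring.
Qed.

Lemma half_ge0 a : (0 <= a + a)%A -> (0 <= a)%A.
Proof.
  intros H. apply (scal_cancel 2); [lra|]. replace 2 with (1 + 1) by lra.
  rewrite rcstD, rcst1. now replace ((1 + 1) * a)%A with (a + a)%A by ring.
Qed.

Lemma mul_le_l a b c : (0 <= c)%A -> (a <= b)%A -> (c * a <= c * b)%A.
Proof.
  intros Hc H. apply le_of_sub. replace (c * b - c * a)%A with (c * (b - a))%A by ring.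
  apply ble_mul; auto. now apply sub_ge0.
Qed.

Lemma opp_le a b : (a <= b)%A -> (- b <= - a)%A.
Proof. intros. apply le_of_sub. replace (- a - - b)%A with (b - a)%A by ring. now apply sub_ge0. Qed.

Lemma bounded_both a : exists C, 0 <= C /\ (a <= rcst C)%A /\ (- a <= rcst C)%A.
Proof.
  destruct (bbounded A a) as [n [_ Hn]]. destruct (bbounded A (- a)%A) as [m [_ Hm]].
  pose proof (pos_INR n). pose proof (pos_INR m).
  exists (INR n + INR m). split; [lra|]. split.
  - apply ble_trans with (1 := Hn). apply rcst_le; lra.
  - apply ble_trans with (1 := Hm). apply rcst_le; lra.
Qed.

Lemma abs_le a t : (babs A a <= t)%A <-> (a <= t)%A /\ (- a <= t)%A.
Proof.
  unfold babs. split.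
  - intros H; split; eapply ble_trans; [apply bjoin_l | exact H | apply bjoin_r | exact H].
  - intros []; now apply bjoin_lub.
Qed.

Lemma le_abs a : (a <= babs A a)%A /\ (- a <= babs A a)%A.
Proof. apply abs_le, ble_refl. Qed.

Lemma abs_ge0 a : (0 <= babs A a)%A.
Proof.
  apply half_ge0. replace (@rzero A) with (a + - a)%A by ring.
  apply ble_add2; apply le_abs.
Qed.

Lemma pos_ge0 a : (0 <= bpos A a)%A. Proof. apply bjoin_r. Qed.
Lemma neg_ge0 a : (0 <= bneg a)%A. Proof. apply bjoin_r. Qed.

Lemma pos_sub_neg a : (bpos A a - bneg a)%A = a.
Proof.
  assert (H : (bpos A a = a + bneg a)%A).
  { apply ble_anti.
    - apply bjoin_lub; apply le_of_sub.
      + replace (a + bneg a - a)%A with (bneg a) by ring. apply neg_ge0.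
      + replace (a + bneg a - 0)%A with (bneg a - - a)%A by ring. apply sub_ge0, bjoin_l.
    - apply le_of_sub. replace (bpos A a - (a + bneg a))%A with ((bpos A a - a) - bneg a)%A by ring.
      apply sub_ge0. apply bjoin_lub; apply le_of_sub.
      + replace (bpos A a - a - - a)%A with (bpos A a) by ring. apply pos_ge0.
      + replace (bpos A a - a - 0)%A with (bpos A a - a)%A by ring. apply sub_ge0, bjoin_l. }
  rewrite H. ring.
Qed.

(* With [w = u v / C] and [C] bounding [u] and [v], [w] lies below both, hence
   [u - w] is already an upper bound of [a] and [0]. *)
Lemma pos_mul_neg a : (bpos A a * bneg a = 0)%A.
Proof.
  set (u := bpos A a). set (v := bneg a).
  assert (Hu : (0 <= u)%A) by apply pos_ge0. assert (Hv : (0 <= v)%A) by apply neg_ge0.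
  assert (Huv : (u - v)%A = a) by apply pos_sub_neg.
  destruct (bounded_both u) as [C1 [HC1 [Hu1 _]]].
  destruct (bounded_both v) as [C2 [HC2 [Hv1 _]]].
  set (C := C1 + C2 + 1). assert (HC : 0 < C) by (unfold C; lra).
  set (w := (rcst (/ C) * (u * v))%A).
  assert (HCi : 0 <= / C) by now apply Rlt_le, Rinv_0_lt_compat.
  assert (E : forall t, (rcst (/ C) * (rcst C * t))%A = t).
  { intros t. replace (rcst (/ C) * (rcst C * t))%A with (rcst (/ C) * rcst C * t)%A by ring.
    rewrite <- rcstM, Rinv_l, rcst1 by lra. ring. }
  assert (Hwu : (w <= u)%A).
  { rewrite <- (E u). apply scal_le; auto.
    replace (rcst C * u)%A with (u * rcst C)%A by ring. apply mul_le_l; auto.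
    apply ble_trans with (1 := Hv1). apply rcst_le; unfold C; lra. }
  assert (Hwv : (w <= v)%A).
  { rewrite <- (E v). apply scal_le; auto.
    replace (u * v)%A with (v * u)%A by ring.
    replace (rcst C * v)%A with (v * rcst C)%A by ring. apply mul_le_l; auto.
    apply ble_trans with (1 := Hu1). apply rcst_le; unfold C; lra. }
  assert (Hw : (u <= u - w)%A).
  { unfold u at 1. apply bjoin_lub.
    - rewrite <- Huv. apply le_of_sub. replace (u - w - (u - v))%A with (v - w)%A by ring.
      now apply sub_ge0.
    - now apply sub_ge0 in Hwu. }
  apply ble_anti.
  - apply le_of_sub. replace (0 - u * v)%A with (rcst C * (0 - w))%A.
    + apply ble_mul; [apply rcst_ge0; lra|]. apply sub_ge0 in Hw.
      now replace (0 - w)%A with (u - w - u)%A by ring.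
    + unfold w. replace (rcst C * (0 - rcst (/ C) * (u * v)))%A
        with (0 - rcst (/ C) * (rcst C * (u * v)))%A by ring. now rewrite E.
  - now apply ble_mul.
Qed.

Section LIdeal.
Variable I : A -> Prop.
Hypothesis HI : lideal I.

Lemma lideal0 : I 0%A. Proof. apply HI. Qed.
Lemma lidealD a b : I a -> I b -> I (a + b)%A. Proof. apply HI. Qed.
Lemma lidealM a b : I b -> I (a * b)%A. Proof. exact (proj1 (proj2 (proj2 HI)) a b). Qed.
Lemma lideal_solid a t : I t -> (a <= t)%A -> (- a <= t)%A -> I a.
Proof.
  intros Ht H1 H2. apply (proj2 (proj2 (proj2 HI))) with t; auto.
  apply abs_le; split; eapply ble_trans; eauto; apply le_abs.
Qed.
Lemma lideal_le a t : I t -> (0 <= a)%A -> (a <= t)%A -> I a.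
Proof.
  intros Ht H0 H1. apply lideal_solid with t; auto.
  apply ble_trans with a; auto. apply le_of_sub.
  replace (a - - a)%A with (a + a)%A by ring. now apply add_ge0.
Qed.
Lemma lidealN a : I a -> I (- a)%A.
Proof. intros. replace (- a)%A with ((- (1)) * a)%A by ring. now apply lidealM. Qed.
Lemma lidealB a b : I a -> I b -> I (a - b)%A.
Proof. intros. apply lidealD; auto. now apply lidealN. Qed.
Lemma lideal_abs a : I a -> I (babs A a).
Proof.
  intros. apply (proj2 (proj2 (proj2 HI))) with a; auto.
  apply abs_le; split; [apply ble_refl|].
  apply ble_trans with 0%A; [|apply abs_ge0].
  replace 0%A with (- (0) : A)%A by ring. apply opp_le, abs_ge0.
Qed.
Lemma lideal_pos_neg a : I (bpos A a) -> I (bneg a) -> I a.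
Proof. intros. rewrite <- (pos_sub_neg a). now apply lidealB. Qed.
Lemma lideal_full : I 1%A -> forall a, I a.
Proof. intros H a. replace a with (a * 1)%A by ring. now apply lidealM. Qed.
(** A positive real is a unit, so it cannot lie below an element of a proper l-ideal. Real
    inequalities modulo an ideal are read off through this lemma. *)
Lemma proper_rcst r t : proper I -> I t -> (rcst r <= t)%A -> r <= 0.
Proof.
  intros [a Ha] Ht H. apply Rnot_lt_le. intros Hr. apply Ha, lideal_full.
  replace 1%A with (rcst (/ r) * rcst r : A)%A by (rewrite <- rcstM, Rinv_l, rcst1 by lra; auto).
  apply lidealM. apply lideal_le with t; auto. apply rcst_ge0; lra.
Qed.
End LIdeal.

Ltac solve_lideal := repeat match goal with
  | H : ?P |- ?P => exact H
  | H : lideal ?I |- ?I _ =>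
      first [apply (lidealB I H) | apply (lidealD I H) | apply (lidealM I H) | apply (lideal_abs I H)]
  end.

(** For an l-ideal [I] and [c >= 0] this is the l-ideal generated by [I] and [c]. Real multiples of
    [c] suffice in place of algebra multiples because every element is bounded by a real. *)
Definition lideal_adjoin (I : A -> Prop) (c a : A) : Prop :=
  exists (i : A) (k : R), I i /\ (0 <= i)%A /\ 0 <= k /\
    (a <= i + rcst k * c)%A /\ (- a <= i + rcst k * c)%A.

Lemma lideal_adjoin_lideal I c : lideal I -> (0 <= c)%A -> lideal (lideal_adjoin I c).
Proof.
  intros HI Hc. unfold lideal_adjoin. split; [|split; [|split]].
  - exists 0%A, 0. rewrite rcst0. replace (0 + 0 * c)%A with (@rzero A) by ring.
    replace (- (0))%A with (@rzero A) by ring.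
    repeat split; try apply ble_refl; [now apply lideal0 | lra].
  - intros a b [i [k [Hi [Hi0 [Hk [H1 H2]]]]]] [i' [k' [Hi' [Hi0' [Hk' [H1' H2']]]]]].
    exists (i + i')%A, (k + k'). rewrite rcstD.
    replace (i + i' + (rcst k + rcst k') * c)%A
      with (i + rcst k * c + (i' + rcst k' * c))%A by ring.
    replace (- (a + b))%A with (- a + - b)%A by ring.
    repeat split; auto using ble_add2, add_ge0; [solve_lideal | lra].
  - intros a b [i [k [Hi [Hi0 [Hk [H1 H2]]]]]].
    destruct (bounded_both a) as [C [HC [Ha Ha']]].
    set (t := (i + rcst k * c)%A) in *.
    apply sub_ge0 in H1, H2, Ha, Ha'.
    exists (rcst C * i)%A, (C * k). rewrite rcstM.
    replace (rcst C * i + rcst C * rcst k * c)%A with (rcst C * t)%A by (unfold t; ring).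
    assert (0 <= C * k) by now apply Rmult_le_pos.
    (* With [|a| <= C] and [|b| <= t], the bound [|a b| <= C t] follows because twice each
       difference is a sum of two products of nonnegative factors. *)
    assert (Hm : forall u v w z : A, (0 <= u -> 0 <= v -> 0 <= w -> 0 <= z -> 0 <= u * v + w * z)%A)
      by (intros; apply add_ge0; now apply ble_mul).
    repeat split; auto using ble_mul, rcst_ge0;
      [solve_lideal | apply le_of_sub, half_ge0 ..].
    + replace (rcst C * t - a * b + (rcst C * t - a * b))%A
        with ((rcst C - a) * (t - - b) + (rcst C - - a) * (t - b))%A by ring. auto.
    + replace (rcst C * t - - (a * b) + (rcst C * t - - (a * b)))%A
        with ((rcst C - - a) * (t - - b) + (rcst C - a) * (t - b))%A by ring. auto.
  - intros a b Hab [i [k [Hi [Hi0 [Hk [H1 H2]]]]]].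
    exists i, k. repeat split; auto; apply abs_le; apply ble_trans with (1 := Hab);
      now apply abs_le.
Qed.

Lemma lideal_adjoin_l I c a : lideal I -> I a -> lideal_adjoin I c a.
Proof.
  intros HI Ha. exists (babs A a), 0. rewrite rcst0.
  replace (babs A a + 0 * c)%A with (babs A a) by ring.
  repeat split; auto using abs_ge0; try apply le_abs; [solve_lideal | lra].
Qed.

Lemma lideal_adjoin_r I c : lideal I -> (0 <= c)%A -> lideal_adjoin I c c.
Proof.
  intros HI Hc. exists 0%A, 1. rewrite rcst1. replace (0 + 1 * c)%A with c by ring.
  repeat split; try apply ble_refl; [now apply lideal0 | lra |].
  apply le_of_sub. replace (c - - c)%A with (c + c)%A by ring. now apply add_ge0.
Qed.

(** * Real residues modulo a maximal l-ideal *)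

Section Maximal.
Variable M : A -> Prop.
Hypothesis HM : maximal_lideal M.

Let HMl : lideal M := proj1 HM.
Let HMp : proper M := proj1 (proj2 HM).

(** Modulo [M], a nonnegative element outside [M] is bounded below by a positive real: adjoining [c]
    yields everything, so [1 <= i + k c], and one divides. *)
Lemma maximal_not_in c : (0 <= c)%A -> ~ M c ->
  exists k m, 0 < k /\ M m /\ (0 <= m)%A /\ (rcst k <= m + c)%A.
Proof.
  intros Hc Hn.
  destruct (proj2 (proj2 HM) (lideal_adjoin M c)) as [H | H].
  - now apply lideal_adjoin_lideal.
  - intros a; now apply lideal_adjoin_l.
  - destruct Hn. now apply H, lideal_adjoin_r.
  - destruct (H 1%A) as [i [k [Hi [Hi0 [Hk [H1 _]]]]]].
    (* [k] may be zero, so the division is by [k + 1]. *)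
    assert (Hp : 0 < / (k + 1)) by (apply Rinv_0_lt_compat; lra).
    exists (/ (k + 1)), (rcst (/ (k + 1)) * i)%A. repeat split; auto; [solve_lideal | |].
    + apply ble_mul; auto. apply rcst_ge0; lra.
    + replace (rcst (/ (k + 1)))%A with (rcst (/ (k + 1)) * 1 : A)%A by ring.
      replace (rcst (/ (k + 1)) * 1 * i + c)%A with (rcst (/ (k + 1)) * (i + rcst (k + 1) * c))%A.
      * apply scal_le; [lra|]. apply ble_trans with (1 := H1).
        apply ble_add2; [apply ble_refl|].
        rewrite (rmulC A _ c), (rmulC A _ c). apply mul_le_l; auto. apply rcst_le; lra.
      * replace (rcst (/ (k + 1)) * (i + rcst (k + 1) * c))%A
          with (rcst (/ (k + 1)) * 1 * i + (rcst (/ (k + 1)) * rcst (k + 1)) * c)%A by ring.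
        rewrite <- rcstM, Rinv_l, rcst1 by lra. ring.
Qed.

(** If both parts were outside [M], each would exceed a positive real modulo [M], and so would their
    product, which is zero. *)
Lemma maximal_pos_or_neg a : M (bpos A a) \/ M (bneg a).
Proof.
  destruct (classic (M (bpos A a))) as [|Hu]; auto.
  destruct (classic (M (bneg a))) as [|Hv]; auto. exfalso.
  destruct (maximal_not_in _ (pos_ge0 a) Hu) as [k [m [Hk [Hm [Hm0 H]]]]].
  destruct (maximal_not_in _ (neg_ge0 a) Hv) as [k' [m' [Hk' [Hm' [Hm0' H']]]]].
  set (u := bpos A a) in *. set (v := bneg a) in *.
  assert (Hkk : k * k' <= 0); [|pose proof (Rmult_lt_0_compat _ _ Hk Hk'); lra].
  apply (proper_rcst M HMl) with ((m' + v) * m + u * m')%A; auto; [solve_lideal|].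
  replace ((m' + v) * m + u * m')%A with ((m + u) * (m' + v) - u * v)%A by ring.
  unfold u at 2, v at 2. rewrite pos_mul_neg. fold u v.
  replace ((m + u) * (m' + v) - 0)%A with ((m + u) * (m' + v))%A by ring.
  rewrite rcstM. apply ble_trans with (rcst k * (m' + v))%A.
  - apply scal_le; auto; lra.
  - rewrite !(rmulC A _ (m' + v)%A). apply mul_le_l; auto. apply add_ge0; auto. apply neg_ge0.
Qed.

(** A Dedekind cut: [r0] is the supremum of the reals lying below [a] modulo [M]. If the positive
    part of [a - r0] were outside [M], some [r0 + k] would still lie below [a]; if the negative part
    were, [r0 - k] would already bound the cut. *)
Lemma maximal_residue a : exists r, M (a - rcst r)%A.
Proof.
  destruct (bounded_both a) as [C [HC [Ha Ha']]].
  set (S := fun r => M (bneg (a - rcst r)%A)).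
  assert (Hneg : forall r, (rcst r - a <= bneg (a - rcst r))%A).
  { intros r. replace (rcst r - a)%A with (- (a - rcst r))%A by ring. apply bjoin_l. }
  assert (Hb : bound S).
  { exists C. intros r Hr.
    assert (r - C <= 0); [|lra].
    apply (proper_rcst M HMl) with (bneg (a - rcst r)%A); auto.
    apply ble_trans with (2 := Hneg r). rewrite rcstB. apply le_of_sub.
    replace (rcst r - a - (rcst r - rcst C))%A with (rcst C - a)%A by ring. now apply sub_ge0. }
  assert (He : exists r, S r).
  { exists (- C). unfold S. replace (bneg (a - rcst (- C))%A) with (@rzero A).
    - now apply lideal0.
    - apply ble_anti; [apply neg_ge0|]. apply bjoin_lub; [|apply ble_refl].
      rewrite rcstN. apply le_of_sub.
      replace (0 - - (a - - rcst C))%A with (rcst C - - a)%A by ring. now apply sub_ge0. }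
  destruct (completeness S Hb He) as [r0 [Hub Hlub]]. exists r0.
  set (b := (a - rcst r0)%A).
  assert (Hsub := pos_sub_neg b). assert (Hd := maximal_pos_or_neg b).
  apply lideal_pos_neg; auto; apply NNPP; intros Hn.
  - destruct Hd as [Hd | Hd]; [easy|].
    destruct (maximal_not_in _ (pos_ge0 b) Hn) as [k [m [Hk [Hm [Hm0 H]]]]].
    assert (r0 + k <= r0); [|lra]. apply Hub. red.
    apply lideal_le with (m + bneg b)%A; auto using neg_ge0; [solve_lideal|].
    apply bjoin_lub; [|apply add_ge0; auto using neg_ge0].
    apply le_of_sub. rewrite rcstD.
    replace (m + bneg b - - (a - (rcst r0 + rcst k)))%A
      with ((m + bneg b) + b - rcst k)%A by (unfold b; ring).
    rewrite <- Hsub at 2.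
    replace (m + bneg b + (bpos A b - bneg b) - rcst k)%A
      with ((m + bpos A b) - rcst k)%A by ring.
    now apply sub_ge0.
  - destruct Hd as [Hd | Hd]; [|easy].
    destruct (maximal_not_in _ (neg_ge0 b) Hn) as [k [m [Hk [Hm [Hm0 H]]]]].
    assert (r0 <= r0 - k); [|lra]. apply Hlub. intros r Hr.
    assert (r - r0 + k <= 0); [|lra].
    apply (proper_rcst M HMl) with (bneg (a - rcst r) + (m + bpos A b))%A; auto; [solve_lideal|].
    rewrite rcstD, rcstB. apply le_of_sub.
    replace (bneg (a - rcst r) + (m + bpos A b) - (rcst r - rcst r0 + rcst k))%A
      with ((bneg (a - rcst r) - (rcst r - a)) + (m + bpos A b - b - rcst k))%A by (unfold b; ring).
    apply add_ge0; [now apply sub_ge0|].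
    rewrite <- Hsub at 2.
    replace (m + bpos A b - (bpos A b - bneg b) - rcst k)%A with (m + bneg b - rcst k)%A by ring.
    now apply sub_ge0.
Qed.

Lemma maximal_residue_unique a r s : M (a - rcst r)%A -> M (a - rcst s)%A -> r = s.
Proof.
  assert (W : forall r s, M (a - rcst r)%A -> M (a - rcst s)%A -> r <= s).
  { intros r' s' Hr Hs. assert (r' - s' <= 0); [|lra].
    apply (proper_rcst M HMl) with ((a - rcst s') - (a - rcst r'))%A; auto; [solve_lideal|].
    rewrite rcstB. replace (a - rcst s' - (a - rcst r'))%A with (rcst r' - rcst s' : A)%A by ring.
    apply ble_refl. }
  intros; apply Rle_antisym; auto.
Qed.

End Maximal.
End BallgTheory.

(** * Evaluation at maximal l-ideals *)

Local Notation "I ⊆ J" := (forall a, I a -> J a) (at level 70).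

Lemma sig_ext (T : Type) (P : (T -> Prop) -> Prop) (u v : {I | P I}) :
  (forall a, proj1_sig u a <-> proj1_sig v a) -> u = v.
Proof.
  destruct u as [I HI], v as [J HJ]; simpl; intros H.
  assert (I = J) by (apply functional_extensionality; intros; now apply propositional_extensionality).
  subst J. f_equal. apply proof_irrelevance.
Qed.

Section Evaluation.
Variable A : ballg.
Implicit Types (a b : A) (M : Ysp A).

Add Ring A_ring : (ralg_ring A).

Lemma zetaA_spec a M : proj1_sig M (a - rcst (zetaA a M))%A.
Proof.
  unfold zetaA.
  exact (epsilon_spec (inhabits 0) (fun r => proj1_sig M (rsub a (rcst r)))
           (maximal_residue A _ (proj2_sig M) a)).
Qed.

Lemma Ysp_lideal M : lideal (proj1_sig M).
Proof. exact (proj1 (proj2_sig M)). Qed.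

Lemma Ysp_proper M : proper (proj1_sig M).
Proof. exact (proj1 (proj2 (proj2_sig M))). Qed.

Lemma zetaA_eq a M r : proj1_sig M (a - rcst r)%A -> zetaA a M = r.
Proof. intros H. exact (maximal_residue_unique A _ (proj2_sig M) a _ _ (zetaA_spec a M) H). Qed.

Lemma zetaA_cst r M : zetaA (rcst r) M = r.
Proof.
  apply zetaA_eq. replace (rcst r - rcst r)%A with (@rzero A) by ring.
  apply lideal0, Ysp_lideal.
Qed.

Lemma zetaA_add a b M : zetaA (a + b)%A M = zetaA a M + zetaA b M.
Proof.
  apply zetaA_eq. rewrite rcstD.
  replace (a + b - (rcst (zetaA a M) + rcst (zetaA b M)))%A
    with ((a - rcst (zetaA a M)) + (b - rcst (zetaA b M)))%A by ring.
  apply lidealD; auto using zetaA_spec, Ysp_lideal.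
Qed.

Lemma zetaA_mul a b M : zetaA (a * b)%A M = zetaA a M * zetaA b M.
Proof.
  apply zetaA_eq. rewrite rcstM.
  replace (a * b - rcst (zetaA a M) * rcst (zetaA b M))%A
    with (b * (a - rcst (zetaA a M)) + rcst (zetaA a M) * (b - rcst (zetaA b M)))%A by ring.
  apply lidealD; [|apply lidealM|apply lidealM]; auto using zetaA_spec, Ysp_lideal.
Qed.

Lemma zetaA_one M : zetaA 1%A M = 1.
Proof. rewrite <- rcst1. apply zetaA_cst. Qed.

Lemma zetaA_zero M : zetaA 0%A M = 0.
Proof. rewrite <- rcst0. apply zetaA_cst. Qed.

Lemma zetaA_scal r a M : zetaA (rscal r a) M = r * zetaA a M.
Proof. now rewrite rscalE, zetaA_mul, zetaA_cst. Qed.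

Lemma zetaA_opp a M : zetaA (- a)%A M = - zetaA a M.
Proof. rewrite roppE, zetaA_scal. ring. Qed.

Lemma zetaA_sub a b M : zetaA (a - b)%A M = zetaA a M - zetaA b M.
Proof. unfold rsub. now rewrite zetaA_add, zetaA_opp. Qed.

Lemma zetaA_ge0 a M : (0 <= a)%A -> 0 <= zetaA a M.
Proof.
  intros H. assert (- zetaA a M <= 0); [|lra].
  apply (proper_rcst A _ (Ysp_lideal M)) with (a - rcst (zetaA a M))%A.
  - apply Ysp_proper.
  - apply zetaA_spec.
  - rewrite rcstN. apply le_of_sub.
    now replace (a - rcst (zetaA a M) - - rcst (zetaA a M))%A with a by ring.
Qed.

Lemma zetaA_le a b M : (a <= b)%A -> zetaA a M <= zetaA b M.
Proof.
  intros H. apply sub_ge0 in H. apply (zetaA_ge0 _ M) in H. rewrite zetaA_sub in H. lra.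
Qed.

Lemma zetaA_eq0 a M : proj1_sig M a <-> zetaA a M = 0.
Proof.
  split; intros H.
  - apply zetaA_eq. rewrite rcst0. now replace (a - 0)%A with a by ring.
  - pose proof (zetaA_spec a M) as H1. rewrite H, rcst0 in H1.
    now replace (a - 0)%A with a in H1 by ring.
Qed.

(** The values of the two parts are nonnegative, have product zero and differ by the value of [a];
    this determines them, so evaluation need not be shown to preserve joins first. *)
Lemma zetaA_pos_neg a M : zetaA (bpos A a) M = Rmax (zetaA a M) 0 /\
  zetaA (bneg a) M = Rmax (- zetaA a M) 0.
Proof.
  assert (H1 : zetaA (bpos A a) M * zetaA (bneg a) M = 0)
    by now rewrite <- zetaA_mul, pos_mul_neg, zetaA_zero.
  assert (H2 : zetaA (bpos A a) M - zetaA (bneg a) M = zetaA a M)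
    by now rewrite <- zetaA_sub, pos_sub_neg.
  assert (H3 := zetaA_ge0 _ M (pos_ge0 A a)). assert (H4 := zetaA_ge0 _ M (neg_ge0 A a)).
  rewrite <- H2. apply Rmult_integral in H1.
  destruct H1 as [H1 | H1]; rewrite H1 in *; unfold Rmax; split; destruct Rle_dec; lra.
Qed.

Lemma Ysp_pos a M : proj1_sig M (bpos A a) <-> zetaA a M <= 0.
Proof.
  rewrite zetaA_eq0, (proj1 (zetaA_pos_neg a M)). unfold Rmax; destruct Rle_dec; lra.
Qed.

Lemma Ysp_neg a M : proj1_sig M (bneg a) <-> 0 <= zetaA a M.
Proof.
  rewrite zetaA_eq0, (proj2 (zetaA_pos_neg a M)). unfold Rmax; destruct Rle_dec; lra.
Qed.

Lemma Ysp_arch M : arch_lideal (proj1_sig M).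
Proof.
  split; [apply Ysp_lideal|]. intros a b H. apply Ysp_pos. apply Rnot_lt_le. intros Ha.
  (* A multiple [n] beyond the quotient of the two values contradicts the hypothesis at [n]; the
     maximum with [1] ensures [n >= 1]. *)
  destruct (INR_unbounded (Rmax 1 (zetaA b M / zetaA a M))) as [n Hn].
  assert (H1 : 1 < INR n) by (eapply Rle_lt_trans; [apply Rmax_l | exact Hn]).
  assert (H2 : zetaA b M / zetaA a M < INR n) by (eapply Rle_lt_trans; [apply Rmax_r | exact Hn]).
  assert (Hn1 : (1 <= n)%nat) by (apply INR_le; simpl; lra).
  apply H in Hn1. rewrite Ysp_pos, zetaA_sub, zetaA_scal in Hn1.
  apply (Rmult_lt_compat_r _ _ _ Ha) in H2. unfold Rdiv in H2.
  rewrite Rmult_assoc, Rinv_l in H2; lra.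
Qed.

Definition Ysp_Arch M : Arch A := exist _ (proj1_sig M) (Ysp_arch M).
Definition Ysp_Xsp M : Xsp A := exist _ (proj1_sig M) (conj (Ysp_arch M) (Ysp_proper M)).

Lemma Ysp_maximal M J : lideal J -> proper J -> proj1_sig M ⊆ J -> J ⊆ proj1_sig M.
Proof.
  intros HJ [a Ha] H. destruct (proj2 (proj2 (proj2_sig M)) J HJ H) as [|H1]; auto.
  now destruct (Ha (H1 a)).
Qed.

(** The product of an element of [I] and one of [J], both outside [M], lies in the intersection, and
    its value is a product of nonzero reals. Primality is what makes [M] induce an ultrafilter. *)
Lemma Ysp_prime M (I J : A -> Prop) : lideal I -> lideal J ->
  ~ I ⊆ proj1_sig M -> ~ J ⊆ proj1_sig M -> ~ (fun a => I a /\ J a) ⊆ proj1_sig M.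
Proof.
  intros HI HJ H1 H2 H.
  apply not_all_ex_not in H1, H2. destruct H1 as [a Ha], H2 as [b Hb].
  apply imply_to_and in Ha, Hb. destruct Ha as [Ha Ha'], Hb as [Hb Hb'].
  assert (Hab : proj1_sig M (a * b)%A).
  { apply H. split; [|now apply lidealM]. rewrite rmulC. now apply lidealM. }
  rewrite zetaA_eq0 in Ha', Hb', Hab. rewrite zetaA_mul in Hab.
  apply Rmult_integral in Hab. tauto.
Qed.

End Evaluation.

Lemma lideal_in_maximal (A : ballg) (I : A -> Prop) : lideal I -> proper I ->
  exists M : Ysp A, I ⊆ proj1_sig M.
Proof.
  intros HI [z Hz].
  set (P := fun K : A -> Prop => lideal K /\ proper K /\ I ⊆ K).
  (* The empty predicate is admitted so that the empty chain has a union in the family. *)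
  destruct (@classical_sets.Zorn_bigcup A (fun K => (forall a, ~ K a) \/ P K))
    as [M [HM Hmax]].
  - intros F HF Htot.
    assert (E : classical_sets.bigcup F (fun K => K) = (fun a => exists K, F K /\ K a)).
    { apply functional_extensionality; intros a. apply propositional_extensionality.
      split; [intros [K HK Ka]; eauto | intros [K [HK Ka]]; exact (ex_intro2 _ _ K HK Ka)]. }
    rewrite E.
    destruct (classic (exists K, F K /\ exists a, K a)) as [[K0 [HK0 [a0 Ha0]]] | Hn].
    + right.
      assert (HFP : forall K a, F K -> K a -> P K).
      { intros K a HK Ha. destruct (HF K HK) as [H|]; auto. now destruct (H a). }
      repeat split.
      * exists K0; split; auto. apply lideal0. now apply (HFP K0 a0).
      * intros a b [K [HK Ka]] [L [HL Lb]].
        destruct (Htot K L HK HL) as [Hs | Hs].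
        -- exists L; split; auto. apply lidealD; auto. now apply (HFP L b).
        -- exists K; split; auto. apply lidealD; auto. now apply (HFP K a).
      * intros a b [K [HK Kb]]. exists K; split; auto. apply lidealM; auto. now apply (HFP K b).
      * intros a b Hab [K [HK Kb]]. exists K; split; auto.
        destruct (HFP K b HK Kb) as [HKl _].
        exact (proj2 (proj2 (proj2 HKl)) a b Hab Kb).
      (* Properness passes to the union because an l-ideal containing the unit is everything. *)
      * exists 1%A. intros [K [HK K1]]. destruct (HFP K _ HK K1) as [HKl [[y Hy] _]].
        now apply Hy, lideal_full.
      * intros a Ha. exists K0; split; auto. now apply (HFP K0 a0).
    + left. intros a [K [HK Ka]]. apply Hn. eauto.
  - assert (HIP : P I) by (split; [|split]; auto; now exists z).
    destruct HM as [HM | HM].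
    { exfalso. apply (Hmax I); [|now right]. split.
      - intros a Ha. now destruct (HM a).
      - intros H. apply (HM 0%A), H. now apply lideal0. }
    destruct HM as [HM1 [HM2 HM3]].
    assert (HMax : maximal_lideal M).
    { split; [|split]; auto. intros J HJ HMJ.
      destruct (classic (J ⊆ M)) as [|HnJ]; auto. right.
      apply NNPP. intros Hall. apply (Hmax J).
      - split; auto.
      - right. split; [|split]; auto. now apply not_all_ex_not. }
    exists (exist _ M HMax). exact HM3.
Qed.

Section Spatiality.
Variable A : ballg.
Add Ring A_ring : (ralg_ring A).

(** The archimedean property of [I], tested on [c = |a|] against [1], gives [n] such that the
    positive part of [b = n c - 1] is outside [I]. A maximal l-ideal containing [I] and the negative
    part of [b] has [n c >= 1] there, so it omits [a]. *)
Lemma arch_lideal_separation (I : A -> Prop) (a : A) : arch_lideal I -> ~ I a ->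
  exists M : Ysp A, I ⊆ proj1_sig M /\ ~ proj1_sig M a.
Proof.
  intros [HI Harch] Ha. set (c := babs A a).
  assert (Hn : exists n : nat, (1 <= n)%nat /\ ~ I (bpos A (rscal (INR n) c - 1)%A)).
  { apply NNPP. intros H. apply Ha.
    apply lideal_solid with (bpos A c); auto.
    - apply Harch with 1%A. intros n Hn. apply NNPP. intros H1. apply H. eauto.
    - apply ble_trans with c; [apply le_abs | apply bjoin_l].
    - apply ble_trans with c; [apply le_abs | apply bjoin_l]. }
  destruct Hn as [n [Hn1 Hn]]. set (b := (rscal (INR n) c - 1)%A) in *.
  destruct (lideal_in_maximal A (lideal_adjoin A I (bneg b))) as [M HM].
  - apply lideal_adjoin_lideal; auto. apply neg_ge0.
  - exists 1%A. intros [i [k [Hi [Hi0 [Hk [H1 _]]]]]]. apply Hn.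
    apply lideal_le with (bpos A b * i)%A; auto.
    + now apply lidealM.
    + apply pos_ge0.
    (* Multiplying [1 <= i + k b^-] by [b^+] kills the last term and would put [b^+] into [I]. *)
    + apply (mul_le_l A _ _ (bpos A b)) in H1; [|apply pos_ge0].
      replace (bpos A b * 1)%A with (bpos A b) in H1 by ring.
      replace (bpos A b * (i + rcst k * bneg b))%A
        with (bpos A b * i + rcst k * (bpos A b * bneg b))%A in H1 by ring.
      rewrite pos_mul_neg in H1.
      now replace (bpos A b * i + rcst k * 0)%A with (bpos A b * i)%A in H1 by ring.
  - exists M. split.
    + intros y Hy. now apply HM, lideal_adjoin_l.
    + intros HMa.
      assert (Hb : proj1_sig M (bneg b)) by (apply HM, lideal_adjoin_r; auto; apply neg_ge0).
      apply Ysp_neg in Hb. unfold b in Hb. rewrite zetaA_sub, zetaA_scal, zetaA_one in Hb.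
      assert (Hc : zetaA c M = 0) by (apply zetaA_eq0, lideal_abs; auto; apply Ysp_lideal).
      rewrite Hc in Hb. lra.
Qed.

Lemma Xsp_below_Ysp (J : Xsp A) : exists M : Ysp A, proj1_sig J ⊆ proj1_sig M.
Proof. destruct J as [J HJ]. apply lideal_in_maximal; apply HJ. Qed.

Lemma arch_lideal_subset (I J : A -> Prop) : arch_lideal J ->
  (forall M : Ysp A, J ⊆ proj1_sig M -> I ⊆ proj1_sig M) -> I ⊆ J.
Proof.
  intros HJ H a Ha. apply NNPP. intros Hn.
  destruct (arch_lideal_separation J a HJ Hn) as [M [HM HMa]]. apply HMa. eapply H; eauto.
Qed.

(** This is where the archimedean axiom of the algebra itself enters; with separation it says that
    the maximal l-ideals intersect in zero. *)
Lemma arch_lideal_zero : arch_lideal (fun a : A => a = 0%A).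
Proof.
  assert (Hp : forall a : A, bpos A a = 0%A <-> (a <= 0)%A).
  { intros a; split; intros H.
    - rewrite <- H. apply bjoin_l.
    - apply ble_anti; [|apply pos_ge0]. apply bjoin_lub; auto. apply ble_refl. }
  split; [split; [|split; [|split]]|].
  - reflexivity.
  - intros a b Ha Hb. rewrite Ha, Hb. ring.
  - intros a b Hb. rewrite Hb. ring.
  - intros a b H Hb. rewrite Hb in H.
    assert (H0 : (babs A 0 <= 0)%A).
    { apply abs_le. replace (- (0))%A with (@rzero A) by ring. split; apply ble_refl. }
    assert (H1 := ble_trans A _ _ _ H H0). apply abs_le in H1. destruct H1 as [H1 H2].
    apply ble_anti; auto. apply opp_le in H2.
    now replace (- - a)%A with a in H2 by ring; replace (- (0))%A with (@rzero A) in H2 by ring.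
  - intros a b H. apply Hp. apply (barchimedean A a b). intros n Hn.
    specialize (H n Hn). apply Hp in H. apply le_of_sub.
    apply sub_ge0 in H.
    now replace (0 - (rscal (INR n) a - b))%A with (b - rscal (INR n) a)%A in H by ring.
Qed.

Lemma ble_zetaA (a b : A) : (a <= b)%A <-> forall M, zetaA a M <= zetaA b M.
Proof.
  split; [intros; now apply zetaA_le|]. intros H.
  assert (H0 : bpos A (a - b)%A = 0%A).
  { apply (arch_lideal_subset (fun c => c = bpos A (a - b)%A) (fun c => c = 0%A));
      auto using arch_lideal_zero.
    intros M _ c Hc. rewrite Hc. apply Ysp_pos. rewrite zetaA_sub. specialize (H M). lra. }
  apply le_of_sub. replace (b - a)%A with (0 - (a - b))%A by ring.
  apply sub_ge0. rewrite <- H0. apply bjoin_l.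
Qed.

Lemma eq_zetaA (a b : A) : (forall M, zetaA a M = zetaA b M) -> a = b.
Proof. intros H. apply ble_anti; apply ble_zetaA; intros M; rewrite H; lra. Qed.

End Spatiality.

(** * Ultrafilters of the free boolean extension *)

Section ArchLattice.
Variable A : ballg.
Implicit Types I J K : Arch A.

Lemma arch_lideal_cap (I J : A -> Prop) : arch_lideal I -> arch_lideal J ->
  arch_lideal (fun a => I a /\ J a).
Proof.
  intros [HI HIa] [HJ HJa]. split; [split; [|split; [|split]]|].
  - split; now apply lideal0.
  - intros a b [] []; split; now apply lidealD.
  - intros a b []; split; now apply lidealM.
  - intros a b H []; split; [apply (proj2 (proj2 (proj2 HI))) with b
                            | apply (proj2 (proj2 (proj2 HJ))) with b]; auto.
  - intros a b H; split; [apply HIa with b | apply HJa with b]; intros; now apply H.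
Qed.

Lemma arch_lideal_join (I J : A -> Prop) : arch_lideal (archjoin I J).
Proof.
  split; [split; [|split; [|split]]|].
  - intros K [HK _] _ _. now apply lideal0.
  - intros a b Ha Hb K HK HI HJ. apply lidealD; [apply HK | apply Ha | apply Hb]; auto.
  - intros a b Hb K HK HI HJ. apply lidealM; [apply HK | apply Hb]; auto.
  - intros a b H Hb K HK HI HJ. apply (proj2 (proj2 (proj2 (proj1 HK)))) with b; auto. now apply Hb.
  - intros a b H K HK HI HJ. apply (proj2 HK) with b. intros n Hn. now apply (H n Hn K).
Qed.

Lemma arch_lideal_full : arch_lideal (fun _ : A => True).
Proof. repeat split. Qed.

Definition Arch_cap I J : Arch A := exist _ _ (arch_lideal_cap _ _ (proj2_sig I) (proj2_sig J)).
Definition Arch_join I J : Arch A :=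
  exist _ _ (arch_lideal_join (proj1_sig I) (proj1_sig J)).
Definition Arch_bot : Arch A := exist _ _ (arch_lideal_zero A).
Definition Arch_top : Arch A := exist _ _ arch_lideal_full.

Lemma archjoin_subset_iff (I J K : A -> Prop) : arch_lideal K ->
  archjoin I J ⊆ K <-> I ⊆ K /\ J ⊆ K.
Proof.
  intros HK; split.
  - intros H; split; intros a Ha; apply H; intros L _ HI HJ; auto.
  - intros [HI HJ] a Ha. now apply Ha.
Qed.

Lemma Ysp_not_full (M : Ysp A) : ~ (fun _ => True) ⊆ proj1_sig M.
Proof. intros H. destruct (Ysp_proper A M) as [a Ha]. now apply Ha, H. Qed.

Lemma Ysp_bot (M : Ysp A) : proj1_sig Arch_bot ⊆ proj1_sig M.
Proof. intros a Ha. simpl in Ha. rewrite Ha. apply lideal0, Ysp_lideal. Qed.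

Lemma Ysp_cap_iff (M : Ysp A) I J :
  proj1_sig (Arch_cap I J) ⊆ proj1_sig M <->
  proj1_sig I ⊆ proj1_sig M \/ proj1_sig J ⊆ proj1_sig M.
Proof.
  split.
  - intros H. apply NNPP. intros Hn. apply not_or_and in Hn.
    apply (Ysp_prime A M (proj1_sig I) (proj1_sig J)); try tauto.
    + apply (proj2_sig I).
    + apply (proj2_sig J).
  - intros [H | H] a [Ha Ha']; auto.
Qed.

Lemma Ysp_subset_eq (M N : Ysp A) : proj1_sig M ⊆ proj1_sig N -> M = N.
Proof.
  intros H. apply sig_ext. intros a; split; auto.
  apply Ysp_maximal; auto using Ysp_lideal, Ysp_proper.
Qed.

End ArchLattice.

Arguments Arch_cap {A}. Arguments Arch_join {A}. Arguments Arch_bot {A}. Arguments Arch_top {A}.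
Arguments Ysp_Arch {A}. Arguments Ysp_Xsp {A}.

Section BooleanOrder.
Variable B : boolalg.
Implicit Types a b c d : B.

Definition bole a b := bm a b = a.

Lemma bm_idem a : bm a a = a.
Proof. rewrite <- (bjabs B a a) at 2. apply bmabs. Qed.
Lemma bole_trans a b c : bole a b -> bole b c -> bole a c.
Proof. unfold bole; intros H1 H2. rewrite <- H1, <- bmA, H2. reflexivity. Qed.
Lemma bm_lel a b : bole (bm a b) a.
Proof. unfold bole. now rewrite (bmC B (bm a b)), bmA, bm_idem. Qed.
Lemma bm_ler a b : bole (bm a b) b.
Proof. rewrite bmC. apply bm_lel. Qed.
Lemma bm_glb a b c : bole c a -> bole c b -> bole c (bm a b).
Proof. unfold bole; intros H1 H2. now rewrite bmA, H1. Qed.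
Lemma bj_gel a b : bole a (bj a b).
Proof. apply bmabs. Qed.
Lemma bj_ger a b : bole b (bj a b).
Proof. rewrite bjC. apply bmabs. Qed.
Lemma bj_lub a b c : bole a c -> bole b c -> bole (bj a b) c.
Proof. unfold bole; intros H1 H2. rewrite bmC, bdistr, (bmC B c a), (bmC B c b). now rewrite H1, H2. Qed.
Lemma b0_le a : bole b0 a.
Proof. unfold bole. rewrite <- (bj0 B a), (bjC B a). apply bmabs. Qed.

Lemma bole_shift a b c : bole (bm a b) c -> bole a (bj (bc b) c).
Proof.
  intros H. rewrite <- (bm1 B a), <- (bjc B b), bdistr. apply bj_lub.
  - eapply bole_trans; [exact H | apply bj_ger].
  - eapply bole_trans; [apply bm_ler | apply bj_gel].
Qed.

Lemma bole_unshift a b c : bole a (bj b c) -> bole (bm a (bc b)) c.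
Proof.
  intros H. apply bole_trans with (bm (bc b) (bj b c)).
  - apply bm_glb; [apply bm_ler | eapply bole_trans; [apply bm_lel | exact H]].
  - rewrite bdistr, (bmC B (bc b) b), bmc. apply bj_lub; [apply b0_le | apply bm_ler].
Qed.

(** The nontrivial half of the dual distributive law, needed to close [ult] under meets. *)
Lemma bj_bm_le a b c : bole (bm (bj a c) (bj b c)) (bj (bm a b) c).
Proof.
  rewrite bdistr, (bmC B _ b), bdistr. apply bj_lub; [apply bj_lub|].
  - rewrite bmC. apply bj_gel.
  - eapply bole_trans; [apply bm_ler | apply bj_ger].
  - eapply bole_trans; [apply bm_ler | apply bj_ger].
Qed.

End BooleanOrder.

Arguments bole {B}.

Section Ultrafilter.
Variables (A : ballg) (B : boolalg) (e : Arch A -> B).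
Hypothesis He : free_bool_ext e.

Lemma e_cap I J : e (Arch_cap I J) = bm (e I) (e J).
Proof. apply (proj1 (proj2 He)). intros a; reflexivity. Qed.
Lemma e_join I J : e (Arch_join I J) = bj (e I) (e J).
Proof. apply (proj1 (proj2 (proj2 He))). intros a; reflexivity. Qed.
Lemma e_bot : e Arch_bot = b0.
Proof. apply (proj1 (proj2 (proj2 (proj2 He)))). intros a; reflexivity. Qed.
Lemma e_top : e Arch_top = b1.
Proof. apply (proj1 (proj2 (proj2 (proj2 (proj2 He))))). intros a; exact Logic.I. Qed.

Lemma e_le I J : bole (e I) (e J) -> proj1_sig I ⊆ proj1_sig J.
Proof.
  unfold bole. rewrite <- e_cap. intros H a Ha. apply (proj1 He) in H.
  rewrite <- H in Ha. apply Ha.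
Qed.

Lemma e_mono I J : proj1_sig I ⊆ proj1_sig J -> bole (e I) (e J).
Proof.
  intros H. unfold bole. rewrite <- e_cap. f_equal. apply sig_ext. simpl. intros a; split; [tauto|auto].
Qed.

Variable M : Ysp A.
Notation inM I := (proj1_sig I ⊆ proj1_sig M).

(* [ult b] and [coult b] are the two halves of the partition of [B] induced by [M];
   they are stated without complements, so that every step is a lattice computation. *)
Definition ult (b : B) : Prop := exists I J, ~ inM I /\ inM J /\ bole (e I) (bj b (e J)).
Definition coult (b : B) : Prop := exists I J, ~ inM I /\ inM J /\ bole (bm (e I) b) (e J).

Lemma inM_join I J : inM I -> inM J -> inM (Arch_join I J).
Proof. intros HI HJ. exact (proj2 (archjoin_subset_iff A _ _ _ (Ysp_arch A M)) (conj HI HJ)). Qed.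

Lemma ninM_cap I J : ~ inM I -> ~ inM J -> ~ inM (Arch_cap I J).
Proof. rewrite Ysp_cap_iff. tauto. Qed.

(** Combining both witnesses eliminates [b] and leaves an inequality between images of [e]. As [e]
    is injective, it reflects to [I ∩ I'] being contained in [J' ∨ J], hence in [M], against
    primality. *)
Lemma ult_coult b : ult b -> coult b -> False.
Proof.
  intros [I [J [HI [HJ H]]]] [I' [J' [HI' [HJ' H']]]].
  apply (ninM_cap I I' HI HI'). intros a Ha. apply (inM_join J' J HJ' HJ).
  apply (e_le (Arch_cap I I')); auto. rewrite e_cap, e_join.
  apply bole_trans with (bm (e I') (bj b (e J))).
  - apply bm_glb; [apply bm_ler | eapply bole_trans; [apply bm_lel | exact H]].
  - rewrite bdistr. apply bj_lub.
    + eapply bole_trans; [exact H' | apply bj_gel].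
    + eapply bole_trans; [apply bm_ler | apply bj_ger].
Qed.

Lemma ult_up b c : bole b c -> ult b -> ult c.
Proof.
  intros Hbc [I [J [HI [HJ H]]]]. exists I, J. repeat split; auto.
  eapply bole_trans; [exact H|]. apply bj_lub; [|apply bj_ger].
  eapply bole_trans; [exact Hbc | apply bj_gel].
Qed.

Lemma coult_down b c : bole b c -> coult c -> coult b.
Proof.
  intros Hbc [I [J [HI [HJ H]]]]. exists I, J. repeat split; auto.
  eapply bole_trans; [|exact H]. apply bm_glb; [apply bm_lel|].
  eapply bole_trans; [apply bm_ler | exact Hbc].
Qed.

Lemma ult_bm b c : ult b -> ult c -> ult (bm b c).
Proof.
  intros [I [J [HI [HJ H]]]] [I' [J' [HI' [HJ' H']]]].
  exists (Arch_cap I I'), (Arch_join J J').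
  split; [now apply ninM_cap|]. split; [now apply inM_join|]. rewrite e_cap, e_join.
  eapply bole_trans; [|apply bj_bm_le]. apply bm_glb.
  - eapply bole_trans; [apply bm_lel|]. eapply bole_trans; [exact H|].
    rewrite bjA. apply bj_gel.
  - eapply bole_trans; [apply bm_ler|]. eapply bole_trans; [exact H'|].
    rewrite (bjC B (e J)), bjA. apply bj_gel.
Qed.

Lemma coult_bj b c : coult b -> coult c -> coult (bj b c).
Proof.
  intros [I [J [HI [HJ H]]]] [I' [J' [HI' [HJ' H']]]].
  exists (Arch_cap I I'), (Arch_join J J').
  split; [now apply ninM_cap|]. split; [now apply inM_join|]. rewrite e_cap, e_join.
  rewrite bdistr. apply bj_lub.
  - apply bole_trans with (bm (e I) b).
    + apply bm_glb; [|apply bm_ler]. eapply bole_trans; apply bm_lel.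
    + eapply bole_trans; [exact H | apply bj_gel].
  - apply bole_trans with (bm (e I') c).
    + apply bm_glb; [|apply bm_ler]. eapply bole_trans; [apply bm_lel | apply bm_ler].
    + eapply bole_trans; [exact H' | apply bj_ger].
Qed.

Lemma ult_bc b : ult b -> coult (bc b).
Proof. intros [I [J [HI [HJ H]]]]. exists I, J. repeat split; auto. now apply bole_unshift. Qed.

Lemma coult_bc b : coult b -> ult (bc b).
Proof. intros [I [J [HI [HJ H]]]]. exists I, J. repeat split; auto. now apply bole_shift. Qed.

Lemma ult_e I : ~ inM I -> ult (e I).
Proof.
  intros H. exists I, Arch_bot. repeat split; auto using bj_gel. apply Ysp_bot.
Qed.

Lemma coult_e I : inM I -> coult (e I).
Proof.
  intros H. exists Arch_top, I. repeat split; auto using bm_ler. apply Ysp_not_full.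
Qed.

(** Induction over the generation of [B] by the image of [e]: the elements on one side or the other
    form a boolean subalgebra containing every [e I]. *)
Lemma ult_or_coult b : ult b \/ coult b.
Proof.
  apply (proj2 (proj2 (proj2 (proj2 (proj2 He)))) (fun b => ult b \/ coult b)).
  - intros I. destruct (classic (inM I)); [right; now apply coult_e | left; now apply ult_e].
  - right. rewrite <- e_bot. apply coult_e, Ysp_bot.
  - left. rewrite <- e_top. apply ult_e, Ysp_not_full.
  - intros u v [Hu | Hu] [Hv | Hv]; [left; now apply ult_bm | right ..].
    + apply (coult_down _ v); auto using bm_ler.
    + apply (coult_down _ u); auto using bm_lel.
    + apply (coult_down _ u); auto using bm_lel.
  - intros u v [Hu | Hu] [Hv | Hv]; [left .. | right; now apply coult_bj].
    + apply (ult_up u); auto using bj_gel.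
    + apply (ult_up u); auto using bj_gel.
    + apply (ult_up v); auto using bj_ger.
  - intros u [Hu | Hu]; [right; now apply ult_bc | left; now apply coult_bc].
Qed.

Lemma ult_bm_iff b c : ult (bm b c) <-> ult b /\ ult c.
Proof.
  split; [|intros []; now apply ult_bm].
  intros H; split; [apply (ult_up (bm b c)) | apply (ult_up (bm b c))]; auto using bm_lel, bm_ler.
Qed.

Lemma ult_bj_iff b c : ult (bj b c) <-> ult b \/ ult c.
Proof.
  split.
  - intros H. destruct (ult_or_coult b) as [|Hb]; auto. destruct (ult_or_coult c) as [|Hc]; auto.
    destruct (ult_coult (bj b c)); auto using coult_bj.
  - intros [H | H]; [apply (ult_up b) | apply (ult_up c)]; auto using bj_gel, bj_ger.
Qed.

Lemma ult_bc_iff b : ult (bc b) <-> ~ ult b.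
Proof.
  split.
  - intros H Hb. apply (ult_coult (bc b)); auto using ult_bc.
  - intros H. destruct (ult_or_coult b); [tauto | now apply coult_bc].
Qed.

Lemma ult_b0 : ~ ult b0.
Proof.
  intros H. apply (ult_coult b0 H). rewrite <- e_bot. apply coult_e, Ysp_bot.
Qed.

Lemma ult_e_iff I : ult (e I) <-> ~ inM I.
Proof.
  split; [|apply ult_e]. intros H HI. apply (ult_coult (e I)); auto using coult_e.
Qed.

End Ultrafilter.

Lemma chi_true (T : Type) (P : T -> Prop) y : P y -> chi P y = 1.
Proof. unfold chi. now destruct excluded_middle_informative. Qed.

Lemma chi_false (T : Type) (P : T -> Prop) y : ~ P y -> chi P y = 0.
Proof. unfold chi. now destruct excluded_middle_informative. Qed.

(** * Consequences of the universal property of [R[B]] *)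

Definition real_ralg : ralg.
Proof.
  refine (Build_ralg R Rplus Rmult Ropp 0 1 Rmult _ _ _ _ _ _ _ _ _ _ _ _ _); intros; ring.
Defined.

Section Subalgebra.
Variables (T : ralg) (S : T -> Prop).
Hypothesis S1 : S 1%A.
Hypothesis SD : forall a b, S a -> S b -> S (a + b)%A.
Hypothesis SM : forall a b, S a -> S b -> S (a * b)%A.
Hypothesis SZ : forall r a, S a -> S (rscal r a).

Lemma sub_closedN a : S a -> S (- a)%A.
Proof. intros. rewrite roppE. now apply SZ. Qed.

Lemma sub_closed0 : S 0%A.
Proof. rewrite <- rcst0. now apply SZ. Qed.

Lemma subset_eq (P : T -> Prop) (u v : {a | P a}) : proj1_sig u = proj1_sig v -> u = v.
Proof.
  destruct u as [a Ha], v as [b Hb]; simpl; intros ->. f_equal. apply proof_irrelevance.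
Qed.

Definition subalgebra : ralg.
Proof.
  refine (Build_ralg {a | S a}
    (fun a b => exist _ _ (SD _ _ (proj2_sig a) (proj2_sig b)))
    (fun a b => exist _ _ (SM _ _ (proj2_sig a) (proj2_sig b)))
    (fun a => exist _ _ (sub_closedN _ (proj2_sig a)))
    (exist _ _ sub_closed0) (exist _ _ S1)
    (fun r a => exist _ _ (SZ r _ (proj2_sig a))) _ _ _ _ _ _ _ _ _ _ _ _ _);
  intros; apply subset_eq; simpl.
  - apply raddA.
  - apply raddC.
  - apply radd0.
  - apply raddN.
  - apply rmulA.
  - apply rmulC.
  - apply rmul1.
  - apply rmulDl.
  - apply rscalA.
  - apply rscal1.
  - apply rscalDr.
  - apply rscalDl.
  - apply rscalMl.
Defined.

End Subalgebra.

(** The universal property gives a homomorphism from [RB] into the subalgebra [S]. Followed by the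
    inclusion it is an endomorphism fixing every [x b], so by uniqueness it is the identity. *)
Lemma RB_generated (B : boolalg) (RB : ralg) (x : B -> RB) (S : RB -> Prop) :
  is_RB x -> S 1%A -> (forall a b, S a -> S b -> S (a + b)%A) ->
  (forall a b, S a -> S b -> S (a * b)%A) -> (forall r a, S a -> S (rscal r a)) ->
  (forall b, S (x b)) -> forall a, S a.
Proof.
  intros [Hrel Hu] S1 SD SM SZ Sx a.
  set (T := subalgebra RB S S1 SD SM SZ).
  set (y := fun b => exist _ _ (Sx b) : T).
  assert (Hy : RB_rel y).
  { destruct Hrel as [H1 [H2 [H3 H4]]]. repeat split; intros; apply subset_eq; simpl; auto. }
  destruct (Hu T y Hy) as [h [[Hh Hhx] _]].
  destruct (Hu RB x Hrel) as [k [_ Hk]].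
  assert (E1 : k = (fun r => r)) by (apply Hk; repeat split; auto).
  assert (E2 : k = (fun r => proj1_sig (h r))).
  { apply Hk. split.
    - split; [|split; [|split]]; intros.
      + now rewrite (homD _ _ _ Hh).
      + now rewrite (homM _ _ _ Hh).
      + now rewrite (homZ _ _ _ Hh).
      + now rewrite (hom1 _ _ _ Hh).
    - intros b. now rewrite Hhx. }
  assert (E : proj1_sig (h a) = a).
  { transitivity (k a); [now rewrite E2 | now rewrite E1]. }
  rewrite <- E. apply proj2_sig.
Qed.

(** * Coordinates of the Dedekind completion *)

Section Completion.
Variables (A : ballg) (B : boolalg) (e : Arch A -> B) (RB : ralg) (x : B -> RB).
Variables (D : ballg) (j : RB -> D).
Hypothesis He : free_bool_ext e.
Hypothesis Hx : is_RB x.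
Hypothesis Hj : dedekind_completion j.
Implicit Types (M N : Ysp A) (r s : RB) (d : D).
Notation inM I M := (proj1_sig I ⊆ proj1_sig M).

Add Ring RB_ring : (ralg_ring RB).
Add Ring D_ring : (ralg_ring D).

Lemma x_bm b c : x (bm b c) = (x b * x c)%A. Proof. apply Hx. Qed.
Lemma x_bj b c : x (bj b c) = (x b + x c - x b * x c)%A. Proof. apply Hx. Qed.
Lemma x_bc b : x (bc b) = (1 - x b)%A. Proof. apply Hx. Qed.
Lemma x_b0 : x b0 = 0%A. Proof. apply Hx. Qed.
Lemma x_b1 : x b1 = 1%A.
Proof. rewrite <- (bjc B b0), x_bj, x_bc, x_b0. ring. Qed.

Lemma tau_exists M : exists h : RB -> R,
  alg_hom (T := real_ralg) h /\ forall b, h (x b) = chi (ult A B e M) b.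
Proof.
  destruct (proj2 Hx real_ralg (chi (ult A B e M))) as [h [Hh _]]; [|now exists h].
  split; [|split; [|split]]; simpl; intros.
  - destruct (classic (ult A B e M e0)), (classic (ult A B e M f));
      rewrite ?(chi_true _ _ e0), ?(chi_true _ _ f), ?(chi_false _ _ e0), ?(chi_false _ _ f) by auto;
      [rewrite chi_true | rewrite chi_false ..]; try ring; rewrite ult_bm_iff; tauto.
  - unfold rsub; simpl.
    destruct (classic (ult A B e M e0)), (classic (ult A B e M f));
      rewrite ?(chi_true _ _ e0), ?(chi_true _ _ f), ?(chi_false _ _ e0), ?(chi_false _ _ f) by auto;
      [rewrite chi_true .. | rewrite chi_false]; try ring; rewrite ult_bj_iff by auto; tauto.
  - unfold rsub; simpl. destruct (classic (ult A B e M e0)).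
    + rewrite (chi_true _ _ e0), chi_false by (try rewrite ult_bc_iff; tauto). ring.
    + rewrite (chi_false _ _ e0), chi_true by (try rewrite ult_bc_iff; tauto). ring.
  - apply chi_false. now apply ult_b0.
Qed.

Definition tau M : RB -> R := epsilon (inhabits (fun _ => 0))
  (fun h => alg_hom (T := real_ralg) h /\ forall b, h (x b) = chi (ult A B e M) b).

Lemma tau_spec M : alg_hom (T := real_ralg) (tau M) /\
  forall b, tau M (x b) = chi (ult A B e M) b.
Proof. exact (epsilon_spec _ _ (tau_exists M)). Qed.

Lemma tauD M r s : tau M (r + s)%A = tau M r + tau M s.
Proof. exact (homD RB real_ralg _ (proj1 (tau_spec M)) r s). Qed.
Lemma tauM M r s : tau M (r * s)%A = tau M r * tau M s.
Proof. exact (homM RB real_ralg _ (proj1 (tau_spec M)) r s). Qed.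
Lemma tauZ M c r : tau M (rscal c r) = c * tau M r.
Proof. exact (homZ RB real_ralg _ (proj1 (tau_spec M)) c r). Qed.
Lemma tau1 M : tau M 1%A = 1.
Proof. exact (hom1 RB real_ralg _ (proj1 (tau_spec M))). Qed.
Lemma tau0 M : tau M 0%A = 0.
Proof. exact (hom0 RB real_ralg _ (proj1 (tau_spec M))). Qed.
Lemma tauC M c : tau M (rcst c) = c.
Proof. unfold rcst. rewrite tauZ, tau1. ring. Qed.
Lemma tauB M r s : tau M (r - s)%A = tau M r - tau M s.
Proof. unfold rsub. rewrite tauD, roppE, tauZ. ring. Qed.
Lemma tau_e M I : tau M (x (e I)) = chi (fun N => ~ inM I N) M.
Proof.
  rewrite (proj2 (tau_spec M)).
  destruct (classic (inM I M)) as [H | H].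
  - rewrite !chi_false; auto. rewrite ult_e_iff; auto.
  - rewrite !chi_true; auto. rewrite ult_e_iff; auto.
Qed.

Lemma jD r s : j (r + s)%A = (j r + j s)%A. Proof. apply (homD RB D), Hj. Qed.
Lemma jM r s : j (r * s)%A = (j r * j s)%A. Proof. apply (homM RB D), Hj. Qed.
Lemma jZ c r : j (rscal c r) = rscal c (j r). Proof. apply (homZ RB D), Hj. Qed.
Lemma j1 : j 1%A = 1%A. Proof. apply (hom1 RB D), Hj. Qed.
Lemma j0 : j 0%A = 0%A. Proof. apply (hom0 RB D), Hj. Qed.
Lemma jC c : j (rcst c) = rcst c. Proof. apply (homC RB D), Hj. Qed.
Lemma jB r s : j (r - s)%A = (j r - j s)%A. Proof. apply (homB RB D), Hj. Qed.
Lemma j_inj r s : j r = j s -> r = s. Proof. apply Hj. Qed.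
Lemma j_dense d : is_lubD (fun y => exists r, y = j r /\ ble (j r) d) d.
Proof. apply (proj2 (proj2 (proj2 (proj2 (proj2 Hj))))). Qed.

(** The real linear span of the [x (e I)], presented as a list of terms so that the positivity
    argument can peel off one ideal at a time. It is closed under products because
    [x (e I) * x (e J)] belongs to the intersection of [I] and [J]. *)
Inductive espan : RB -> Prop :=
| espan0 : espan 0%A
| espan_add c I r : espan r -> espan (rcst c * x (e I) + r)%A.

Lemma espanD r s : espan r -> espan s -> espan (r + s)%A.
Proof.
  intros Hr Hs. induction Hr as [|c I r Hr IH].
  - now replace (0 + s)%A with s by ring.
  - replace (rcst c * x (e I) + r + s)%A with (rcst c * x (e I) + (r + s))%A by ring.
    now constructor.
Qed.

Lemma espan_mul_e c I r : espan r -> espan (rcst c * x (e I) * r)%A.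
Proof.
  intros Hr. induction Hr as [|c' J r Hr IH].
  - replace (rcst c * x (e I) * 0)%A with (@rzero RB) by ring. constructor.
  - replace (rcst c * x (e I) * (rcst c' * x (e J) + r))%A
      with ((rcst c * rcst c') * (x (e I) * x (e J)) + rcst c * x (e I) * r)%A by ring.
    rewrite <- rcstM, <- x_bm, <- (e_cap _ _ _ He). now constructor.
Qed.

Lemma espanM r s : espan r -> espan s -> espan (r * s)%A.
Proof.
  intros Hr Hs. induction Hr as [|c I r Hr IH].
  - replace (0 * s)%A with (@rzero RB) by ring. constructor.
  - replace ((rcst c * x (e I) + r) * s)%A with (rcst c * x (e I) * s + r * s)%A by ring.
    apply espanD; auto. now apply espan_mul_e.
Qed.

Lemma espanE c I : espan (rcst c * x (e I))%A.
Proof.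
  replace (rcst c * x (e I))%A with (rcst c * x (e I) + 0)%A by ring. repeat constructor.
Qed.

Lemma espanC c : espan (rcst c).
Proof.
  replace (rcst c) with (rcst c * x (e Arch_top))%A; [apply espanE|].
  rewrite (e_top _ _ _ He), x_b1. ring.
Qed.

Lemma espanB r s : espan r -> espan s -> espan (r - s)%A.
Proof.
  intros Hr Hs. replace (r - s)%A with (r + (- (1)) * s)%A by ring.
  apply espanD; auto. apply espanM; auto. rewrite <- rcst1, <- rcstN. apply espanC.
Qed.

(** Two generation arguments are nested: [RB] is generated by the [x b], and [B] by the [e I]. *)
Lemma espan_all r : espan r.
Proof.
  apply (RB_generated B RB x espan Hx); auto using espanD, espanM.
  - rewrite <- rcst1. apply espanC.
  - intros c s Hs. rewrite rscalE. apply espanM; auto using espanC.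
  - apply (proj2 (proj2 (proj2 (proj2 (proj2 He)))) (fun b => espan (x b))).
    + intros I. replace (x (e I)) with (rcst 1 * x (e I))%A; [apply espanE|].
      rewrite rcst1. ring.
    + rewrite x_b0. constructor.
    + rewrite x_b1, <- rcst1. apply espanC.
    + intros u v Hu Hv. rewrite x_bm. now apply espanM.
    + intros u v Hu Hv. rewrite x_bj. auto using espanD, espanB, espanM.
    + intros u Hu. rewrite x_bc, <- rcst1. auto using espanB, espanC.
Qed.

(** The element is idempotent, so its value at each maximal l-ideal of [D] is a square. *)
Lemma j_x_ge0 b : (0 <= j (x b))%A.
Proof.
  apply ble_zetaA. intros N. rewrite zetaA_zero, <- (bm_idem B b), x_bm, jM, zetaA_mul.
  apply Rle_0_sqr.
Qed.

(* The cells [G /\ ~G'] are refined along the ideals occurring in [r]; spatiality says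
   that a cell containing no maximal ideal is zero. *)
Lemma j_ge0_on_cell r : forall c (G G' : Arch A),
  (forall M, ~ inM G M -> inM G' M -> 0 <= c + tau M r) ->
  (0 <= j (x (e G) * (1 - x (e G')) * (rcst c + r)))%A.
Proof.
  induction (espan_all r) as [|k I r Hr IH]; intros c G G' H.
  - destruct (classic (exists M, ~ inM G M /\ inM G' M)) as [[M [HM HM']] | Hn].
    + specialize (H M HM HM'). rewrite tau0 in H.
      replace (x (e G) * (1 - x (e G')) * (rcst c + 0))%A
        with (rcst c * (x (e G) * (1 - x (e G'))))%A by ring.
      rewrite jM, jC, <- x_bc, <- x_bm. apply ble_mul; [apply rcst_ge0; lra | apply j_x_ge0].
    + assert (HG : bole (e G) (e G')).
      { apply (e_mono _ _ _ He). apply arch_lideal_subset; [apply (proj2_sig G')|].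
        intros M HM. apply NNPP. intros HG. apply Hn. eauto. }
      replace (x (e G) * (1 - x (e G')))%A with (@rzero RB).
      * replace (0 * (rcst c + 0))%A with (@rzero RB) by ring. rewrite j0. apply ble_refl.
      * replace (x (e G) * (1 - x (e G')))%A with (x (e G) - x (e G) * x (e G'))%A by ring.
        rewrite <- x_bm. unfold bole in HG. rewrite HG. ring.
  (* The head term [k x_I] is constant on each half of the cell: inside [I] it shifts the constant
     to [c + k], outside [I] it vanishes. This is why the induction generalizes over [c], [G] and
     [G']. *)
  - assert (H1 : (0 <= j (x (e (Arch_cap G I)) * (1 - x (e G')) * (rcst (c + k) + r)))%A).
    { apply IH. intros M HM HM'. rewrite Ysp_cap_iff in HM. apply not_or_and in HM.
      specialize (H M (proj1 HM) HM'). rewrite tauD, tauM, tauC, tau_e, chi_true in H by tauto.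
      lra. }
    assert (H2 : (0 <= j (x (e G) * (1 - x (e (Arch_join G' I))) * (rcst c + r)))%A).
    { apply IH. intros M HM HM'.
      apply (archjoin_subset_iff A _ _ _ (Ysp_arch A M)) in HM'. destruct HM' as [HM' HI].
      specialize (H M HM HM'). rewrite tauD, tauM, tauC, tau_e, chi_false in H by tauto.
      lra. }
    rewrite (e_cap _ _ _ He), x_bm, rcstD in H1.
    rewrite (e_join _ _ _ He), x_bj in H2.
    replace (x (e G) * (1 - x (e G')) * (rcst c + (rcst k * x (e I) + r)))%A with
      (x (e G) * x (e I) * (1 - x (e G')) * (rcst c + rcst k + r) +
       x (e G) * (1 - (x (e G') + x (e I) - x (e G') * x (e I))) * (rcst c + r))%A by ring.
    rewrite jD. now apply add_ge0.
Qed.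

Lemma j_ge0 r : (forall M, 0 <= tau M r) -> (0 <= j r)%A.
Proof.
  intros H. assert (H0 := j_ge0_on_cell r 0 Arch_top Arch_bot).
  rewrite (e_top _ _ _ He), (e_bot _ _ _ He), x_b1, x_b0, rcst0 in H0.
  replace (1 * (1 - 0) * (0 + r))%A with r in H0 by ring.
  apply H0. intros M _ _. specialize (H M). lra.
Qed.

Lemma j_le r s : (forall M, tau M r <= tau M s) -> (j r <= j s)%A.
Proof.
  intros H. apply le_of_sub. rewrite <- jB. apply j_ge0. intros M. rewrite tauB.
  specialize (H M). lra.
Qed.

Lemma tau_inj r s : (forall M, tau M r = tau M s) -> r = s.
Proof. intros H. apply j_inj, ble_anti; apply j_le; intros M; rewrite H; lra. Qed.

(* Since [M] is itself an archimedean ideal, [{M}] is the cell [~M] of [B]. *)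
Definition atom M : RB := x (bc (e (Ysp_Arch M))).

Lemma tau_atom M N : tau N (atom M) = chi (fun N => N = M) N.
Proof.
  unfold atom. rewrite x_bc, tauB, tau1, tau_e.
  destruct (classic (N = M)) as [-> | H].
  - rewrite chi_false, chi_true by (simpl; auto). ring.
  - rewrite chi_true, chi_false; auto; [ring|]. intros H1. apply H.
    symmetry. now apply Ysp_subset_eq.
Qed.

Lemma atom_mul M r : (atom M * r)%A = (rcst (tau M r) * atom M)%A.
Proof.
  apply tau_inj. intros N. rewrite !tauM, tauC, tau_atom.
  destruct (classic (N = M)) as [-> | H]; [ring|]. rewrite chi_false; auto. ring.
Qed.

Lemma j_atom_idem M : (j (atom M) * j (atom M) = j (atom M))%A.
Proof. unfold atom. now rewrite <- jM, <- x_bm, bm_idem. Qed.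

(** The atom is nonnegative and nonzero, since [tau M] sends it to [1]; its real multiples are thus
    ordered like the reals. *)
Lemma j_atom_scal_ge0 M c : (0 <= rcst c * j (atom M))%A -> 0 <= c.
Proof.
  intros H. apply Rnot_lt_le. intros Hc.
  assert (H0 : (j (atom M) <= 0)%A).
  { apply le_of_sub. apply (scal_cancel D (- c)); [lra|]. rewrite rcstN.
    now replace (- rcst c * (0 - j (atom M)))%A with (rcst c * j (atom M))%A by ring. }
  assert (E : atom M = 0%A).
  { apply j_inj. rewrite j0. apply ble_anti; auto. apply j_x_ge0. }
  assert (E1 := tau_atom M M). rewrite E, tau0, chi_true in E1; auto. lra.
Qed.

Lemma j_le_iff r s : (j r <= j s)%A <-> forall M, tau M r <= tau M s.
Proof.
  split; [|apply j_le]. intros H M.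
  assert (0 <= tau M (s - r)%A); [|rewrite tauB in *; lra].
  apply (j_atom_scal_ge0 M). rewrite <- jC, <- jM, <- atom_mul, jM, jB.
  apply ble_mul; [apply j_x_ge0 | now apply sub_ge0].
Qed.

(** The coefficient is the supremum of [tau M r] over the [r] with [j r <= d]. The identity is
    checked at the maximal l-ideals [N] of [D], where the idempotent [j (atom M)] has value [0] or
    [1]. *)
Lemma j_atom_coeff M d : exists c, (j (atom M) * d = rcst c * j (atom M))%A.
Proof.
  destruct (bounded_both D d) as [C [HC [Hd Hd']]].
  set (S := fun c => exists r, (j r <= d)%A /\ c = tau M r).
  destruct (completeness S) as [c [Hub Hlub]].
  - exists C. intros c [r [Hr ->]]. rewrite <- (tauC M C). apply j_le_iff.
    rewrite jC. eapply ble_trans; eauto.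
  - exists (- C), (rcst (- C)). split; [|now rewrite tauC].
    rewrite jC, rcstN. apply opp_le in Hd'. now replace (- - d)%A with d in Hd' by ring.
  - exists c.
    (* By join density it suffices to bound every [j r] below [d]: by [c] on the atom and by the
       global bound [C] off it. Where the atom has value [1], this forces the value of [d] to be at
       most [c]. *)
    assert (Hle : (d <= rcst c * j (atom M) + rcst C * (1 - j (atom M)))%A).
    { apply (j_dense d). intros y [r [-> Hr]].
      rewrite <- !jC, <- j1, <- jB, <- !jM, <- jD. apply j_le. intros N.
      rewrite tauD, !tauM, tauB, tau1, !tauC, tau_atom.
      destruct (classic (N = M)) as [-> | Hn].
      - rewrite chi_true by auto. assert (tau M r <= c); [|lra]. apply Hub. now exists r.
      - rewrite chi_false by auto.
        assert (tau N r <= tau N (rcst C)); [|rewrite tauC in *; lra].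
        apply j_le_iff. rewrite jC. eapply ble_trans; eauto. }
    apply eq_zetaA. intros N. rewrite !zetaA_mul, zetaA_cst.
    assert (HP := f_equal (fun y => zetaA y N) (j_atom_idem M)). simpl in HP.
    rewrite zetaA_mul in HP.
    assert (Hz : zetaA (j (atom M)) N = 0 \/ zetaA (j (atom M)) N = 1).
    { assert (Hz : zetaA (j (atom M)) N * (zetaA (j (atom M)) N - 1) = 0) by lra.
      apply Rmult_integral in Hz. destruct Hz; [left | right]; lra. }
    destruct Hz as [Hz | Hz]; rewrite Hz; [ring|].
    enough (zetaA d N = c) by lra. apply Rle_antisym.
    + apply (zetaA_le D _ _ N) in Hle.
      rewrite zetaA_add, !zetaA_mul, zetaA_sub, zetaA_one, !zetaA_cst, Hz in Hle. lra.
    + apply Hlub. intros c' [r [Hr ->]].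
      apply (zetaA_le D _ _ N) in Hr.
      assert (E := f_equal (fun y => zetaA (j y) N) (atom_mul M r)). simpl in E.
      rewrite !jM, jC, !zetaA_mul, zetaA_cst, Hz in E. lra.
Qed.

Definition coeff d M : R :=
  epsilon (inhabits 0) (fun c => (j (atom M) * d = rcst c * j (atom M))%A).

Lemma coeff_spec d M : (j (atom M) * d = rcst (coeff d M) * j (atom M))%A.
Proof. exact (epsilon_spec _ _ (j_atom_coeff M d)). Qed.

Lemma coeff_eq d M c : (j (atom M) * d = rcst c * j (atom M))%A -> coeff d M = c.
Proof.
  intros H. rewrite coeff_spec in H.
  apply Rle_antisym; apply Rminus_le; apply Ropp_le_cancel; rewrite Ropp_0, Ropp_minus_distr;
    apply (j_atom_scal_ge0 M); rewrite rcstB.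
  - replace ((rcst c - rcst (coeff d M)) * j (atom M))%A
      with (rcst c * j (atom M) - rcst (coeff d M) * j (atom M))%A by ring.
    rewrite H. apply sub_ge0, ble_refl.
  - replace ((rcst (coeff d M) - rcst c) * j (atom M))%A
      with (rcst (coeff d M) * j (atom M) - rcst c * j (atom M))%A by ring.
    rewrite H. apply sub_ge0, ble_refl.
Qed.

Lemma coeffD d d' M : coeff (d + d')%A M = coeff d M + coeff d' M.
Proof.
  apply coeff_eq. rewrite rcstD.
  replace (j (atom M) * (d + d'))%A with (j (atom M) * d + j (atom M) * d')%A by ring.
  rewrite !coeff_spec. ring.
Qed.

Lemma coeffM d d' M : coeff (d * d')%A M = coeff d M * coeff d' M.
Proof.
  apply coeff_eq. rewrite rcstM.
  replace (j (atom M) * (d * d'))%A with (j (atom M) * d * d')%A by ring.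
  rewrite coeff_spec.
  replace (rcst (coeff d M) * j (atom M) * d')%A with (rcst (coeff d M) * (j (atom M) * d'))%A by ring.
  rewrite coeff_spec. ring.
Qed.

Lemma coeffC c M : coeff (rcst c) M = c.
Proof. apply coeff_eq. ring. Qed.

Lemma coeffZ c d M : coeff (rscal c d) M = c * coeff d M.
Proof. now rewrite rscalE, coeffM, coeffC. Qed.

Lemma coeff_j r M : coeff (j r) M = tau M r.
Proof. apply coeff_eq. now rewrite <- jM, atom_mul, jM, jC. Qed.

Lemma coeff_mono d d' M : (d <= d')%A -> coeff d M <= coeff d' M.
Proof.
  intros H. assert (0 <= coeff d' M - coeff d M); [|lra].
  apply (j_atom_scal_ge0 M). rewrite rcstB.
  replace ((rcst (coeff d' M) - rcst (coeff d M)) * j (atom M))%A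
    with (rcst (coeff d' M) * j (atom M) - rcst (coeff d M) * j (atom M))%A by ring.
  rewrite <- !coeff_spec. replace (j (atom M) * d' - j (atom M) * d)%A with (j (atom M) * (d' - d))%A by ring.
  apply ble_mul; [apply j_x_ge0 | now apply sub_ge0].
Qed.

(* [d'] is the infimum of the [j s] above it, because [- d'] is a supremum. *)
Lemma coeff_le d d' : (d <= d')%A <-> forall M, coeff d M <= coeff d' M.
Proof.
  split; [intros; now apply coeff_mono|]. intros H.
  enough (Hs : (- d' <= - d)%A).
  { apply opp_le in Hs. now replace (- - d)%A with d in Hs by ring;
      replace (- - d')%A with d' in Hs by ring. }
  apply (j_dense (- d')%A). intros y [s [-> Hs]].
  replace (j s) with (- - j s)%A by ring. apply opp_le.
  apply (j_dense d). intros y [r [-> Hr]].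
  replace (- j s)%A with (j (0 - s)%A) by (rewrite jB, j0; ring).
  apply j_le. intros M.
  apply coeff_mono with (M := M) in Hr, Hs. specialize (H M).
  rewrite coeff_j in Hr, Hs. rewrite roppE, coeffZ in Hs. rewrite tauB, tau0. lra.
Qed.

Lemma coeff_bdd d : bdd (Ysp A) (coeff d).
Proof.
  destruct (bounded_both D d) as [C [_ [H1 H2]]]. exists C. intros M.
  apply coeff_mono with (M := M) in H1, H2. rewrite roppE, coeffZ in H2.
  rewrite coeffC in H1, H2. apply Rabs_le. lra.
Qed.

(** After a shift making [g] nonnegative, the element is the supremum in [D] of the prescribed
    multiples of the atoms. *)
Lemma coeff_onto g : bdd (Ysp A) g -> exists d, forall M, coeff d M = g M.
Proof.
  intros [C HC].
  assert (Hb : forall M, 0 <= g M + C <= 2 * C).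
  { intros M. specialize (HC M). apply Rabs_le_between in HC. lra. }
  (* The extra constant keeps the family nonempty when there is no maximal l-ideal. In that case [C]
     may be negative, hence [Rabs C]; otherwise the constant lies below all other members. *)
  destruct (proj1 (proj2 (proj2 (proj2 (proj2 Hj))))
    (fun y => y = rcst (- 2 * Rabs C) \/ exists M, y = (rcst (g M + C) * j (atom M))%A))
    as [l [Hub Hlub]].
  - exists (rcst (- 2 * Rabs C)). now left.
  - exists (rcst (2 * Rabs C)). pose proof (Rabs_pos C). pose proof (Rle_abs C).
    intros y [-> | [M ->]]; apply coeff_le; intros N; rewrite ?coeffM, ?coeffC, ?coeff_j; [lra|].
    rewrite tau_atom. specialize (Hb M). destruct (classic (N = M)).
    + rewrite chi_true by auto. lra.
    + rewrite chi_false by auto. lra.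
  - exists (l + rcst (- C))%A. intros M. rewrite coeffD, coeffC.
    enough (coeff l M = g M + C) by lra. apply Rle_antisym.
    (* This upper bound has the desired coordinate at [M] and the crude value [2 C] elsewhere, so it
       caps the supremum at [M] exactly. *)
    + assert (Hl : (l <= rcst (g M + C) * j (atom M) + rcst (2 * C) * j (1 - atom M))%A).
      { apply Hlub. pose proof (Rabs_pos C). pose proof (Rle_abs C).
        intros y [-> | [N ->]]; apply coeff_le; intros N';
          rewrite ?coeffD, ?coeffM, ?coeffC, ?coeff_j, ?tauB, ?tau1, !tau_atom;
          pose proof (Hb M); try pose proof (Hb N);
          destruct (classic (N' = M)) as [-> | Hn];
          [rewrite (chi_true _ (fun N => N = M)) by auto; lra
          |rewrite (chi_false _ (fun N => N = M)) by auto; lra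
          | | ].
        - rewrite (chi_true _ (fun N => N = M)) by auto. destruct (classic (M = N)) as [-> | Hn'].
          + rewrite chi_true by auto. lra.
          + rewrite chi_false by auto. lra.
        - rewrite (chi_false _ (fun N => N = M)) by auto. destruct (classic (N' = N)) as [-> | Hn'].
          + rewrite chi_true by auto. lra.
          + rewrite chi_false by auto. lra. }
      apply coeff_mono with (M := M) in Hl.
      rewrite coeffD, !coeffM, !coeffC, !coeff_j, tauB, tau1, tau_atom, chi_true in Hl by auto. lra.
    + assert (Hl : (rcst (g M + C) * j (atom M) <= l)%A) by (apply Hub; eauto).
      apply coeff_mono with (M := M) in Hl.
      rewrite coeffM, coeffC, coeff_j, tau_atom, chi_true in Hl by auto. lra.
Qed.

End Completion.

(** * Normal functions on the Alexandroff space *)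

Definition is_inf (S : R -> Prop) (m : R) : Prop :=
  (forall z, S z -> m <= z) /\ (forall b, (forall z, S z -> b <= z) -> b <= m).

Lemma Rinf_eq S m : is_inf S m -> Rinf S = m.
Proof.
  intros [H1 H2]. unfold Rinf. rewrite (is_glb_Rbar_unique S (Finite m)); [reflexivity|].
  split.
  - intros z Hz. now apply H1.
  - intros [b| |] Hb; simpl; auto.
    (* If plus infinity is a lower bound, [S] is empty and every real is a lower bound, in
       particular [m + 1]. *)
    assert (m + 1 <= m); [|lra]. apply H2. intros z Hz. destruct (Hb z Hz).
Qed.

Lemma Rsup_eq S m : is_lub S m -> Rsup S = m.
Proof.
  intros [H1 H2]. unfold Rsup. rewrite (is_lub_Rbar_unique S (Finite m)); [reflexivity|].
  split.
  - intros z Hz. now apply H1.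
  - intros [b| |] Hb; simpl; auto.
    assert (m <= m - 1); [|lra]. apply H2. intros z Hz. destruct (Hb z Hz).
Qed.

Lemma Rsup_spec (S : R -> Prop) c : (exists z, S z) -> (forall z, S z -> z <= c) -> is_lub S (Rsup S).
Proof.
  intros H1 H2. destruct (completeness S) as [m Hm]; auto.
  - now exists c.
  - now rewrite (Rsup_eq S m).
Qed.

Lemma Rinf_spec (S : R -> Prop) c : (exists z, S z) -> (forall z, S z -> c <= z) -> is_inf S (Rinf S).
Proof.
  intros [z0 Hz0] H2. destruct (completeness (fun y => S (- y))) as [m [Hm1 Hm2]].
  - exists (- c). intros y Hy. specialize (H2 _ Hy). lra.
  - exists (- z0). now rewrite Ropp_involutive.
  - assert (H : is_inf S (- m)); [|now rewrite (Rinf_eq S (- m))].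
    split.
    + intros z Hz. assert (- z <= m); [|lra]. apply Hm1. now rewrite Ropp_involutive.
    + intros b Hb. assert (m <= - b); [|lra]. apply Hm2. intros y Hy. specialize (Hb _ Hy). lra.
Qed.

Section Normalization.
Variable A : ballg.
Implicit Types (f : Xsp A -> R) (g : Ysp A -> R) (J K : Xsp A) (M : Ysp A).
Notation lowerX := (lower (Xsp A) (@openX A)).
Notation upperX := (upper (Xsp A) (@openX A)).
Notation normX := (normz (Xsp A) (@openX A)).
Notation normalX := (isN (Xsp A) (@openX A)).

Lemma openX_upset J : openX (fun K => proj1_sig J ⊆ proj1_sig K).
Proof. intros K L H1 H2 a Ha. auto. Qed.

(* In the Alexandroff topology the upset of [J] is the least neighbourhood of [J]. *)
Lemma lowerX_eq f J m : bdd (Xsp A) f ->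
  is_inf (fun z => exists K, proj1_sig J ⊆ proj1_sig K /\ z = f K) m -> lowerX f J = m.
Proof.
  intros [c Hc] [H1 H2]. apply Rsup_eq. split.
  - intros y [U [HU [HJ ->]]]. apply H2. intros z [K [HK ->]].
    apply (Rinf_spec _ (- c)); eauto.
    intros z [u [_ ->]]. specialize (Hc u). apply Rabs_le_between in Hc. lra.
  - intros b Hb. apply Hb. exists (fun K => proj1_sig J ⊆ proj1_sig K).
    split; [apply openX_upset|]. split; auto. symmetry. now apply Rinf_eq.
Qed.

Lemma upperX_eq f J m : bdd (Xsp A) f ->
  is_lub (fun z => exists K, proj1_sig J ⊆ proj1_sig K /\ z = f K) m -> upperX f J = m.
Proof.
  intros [c Hc] [H1 H2]. apply Rinf_eq. split.
  - intros y [U [HU [HJ ->]]]. apply H2. intros z [K [HK ->]].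
    apply (Rsup_spec _ c); eauto.
    intros z [u [_ ->]]. specialize (Hc u). apply Rabs_le_between in Hc. lra.
  - intros b Hb. apply Hb. exists (fun K => proj1_sig J ⊆ proj1_sig K).
    split; [apply openX_upset|]. split; auto. symmetry. now apply Rsup_eq.
Qed.

Lemma upperX_spec f J : bdd (Xsp A) f ->
  is_lub (fun z => exists K, proj1_sig J ⊆ proj1_sig K /\ z = f K) (upperX f J).
Proof.
  intros Hf. destruct (Hf) as [c Hc].
  assert (H : is_lub (fun z => exists K, proj1_sig J ⊆ proj1_sig K /\ z = f K)
    (Rsup (fun z => exists K, proj1_sig J ⊆ proj1_sig K /\ z = f K))).
  { apply (Rsup_spec _ c); [exists (f J), J; auto|].
    intros z [K [_ ->]]. specialize (Hc K). apply Rabs_le_between in Hc. lra. }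
  now rewrite (upperX_eq f J _ Hf H).
Qed.

Lemma upperX_bdd f : bdd (Xsp A) f -> bdd (Xsp A) (upperX f).
Proof.
  intros Hf. destruct (Hf) as [c Hc]. exists c. intros J.
  destruct (upperX_spec f J Hf) as [H1 H2]. apply Rabs_le. split.
  - apply Rle_trans with (f J).
    + specialize (Hc J). apply Rabs_le_between in Hc. lra.
    + apply H1. exists J; auto.
  - apply H2. intros z [K [_ ->]]. specialize (Hc K). apply Rabs_le_between in Hc. lra.
Qed.

(** The least neighbourhood of a maximal l-ideal is a single point, so envelopes do not change a
    function there. *)
Lemma Xsp_above_Ysp M K : proj1_sig M ⊆ proj1_sig K -> K = Ysp_Xsp M.
Proof.
  intros H. apply sig_ext. intros a; split; auto.
  destruct (proj2_sig K) as [HK HKp]. apply Ysp_maximal; auto. apply HK.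
Qed.

Definition above J g : R -> Prop := fun z => exists M, proj1_sig J ⊆ proj1_sig M /\ z = g M.

Definition ext g J : R := Rinf (above J g).

Lemma ext_spec g J : bdd (Ysp A) g -> is_inf (above J g) (ext g J).
Proof.
  intros [c Hc]. destruct (Xsp_below_Ysp A J) as [M HM].
  apply (Rinf_spec _ (- c)); [exists (g M), M; auto|].
  intros z [N [_ ->]]. specialize (Hc N). apply Rabs_le_between in Hc. lra.
Qed.

Lemma ext_Ysp g M : ext g (Ysp_Xsp M) = g M.
Proof.
  apply Rinf_eq. split.
  - intros z [N [HN ->]]. simpl in HN. apply Ysp_subset_eq in HN. subst. lra.
  - intros b Hb. apply Hb. exists M. auto.
Qed.

Lemma ext_bdd g : bdd (Ysp A) g -> bdd (Xsp A) (ext g).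
Proof.
  intros Hg. destruct (Hg) as [c Hc]. exists c. intros J.
  destruct (ext_spec g J Hg) as [H1 H2]. destruct (Xsp_below_Ysp A J) as [M HM].
  apply Rabs_le. split.
  - apply H2. intros z [N [_ ->]]. specialize (Hc N). apply Rabs_le_between in Hc. lra.
  - apply Rle_trans with (g M).
    + apply H1. exists M; auto.
    + specialize (Hc M). apply Rabs_le_between in Hc. lra.
Qed.

Lemma ext_le g g' : bdd (Ysp A) g -> bdd (Ysp A) g' ->
  (forall J, ext g J <= ext g' J) <-> forall M, g M <= g' M.
Proof.
  intros Hg Hg'. split.
  - intros H M. rewrite <- (ext_Ysp g), <- (ext_Ysp g'). apply H.
  - intros H J. apply (ext_spec g' J Hg'). intros z [M [HM ->]].
    apply Rle_trans with (g M); auto. apply (ext_spec g J Hg). exists M; auto.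
Qed.

(* Every [K] lies below a maximal ideal, and a maximal ideal is its own upset; hence
   normalization only sees the values at maximal ideals. *)
Lemma normX_ext f : bdd (Xsp A) f -> normX f = ext (fun M => f (Ysp_Xsp M)).
Proof.
  intros Hf. apply functional_extensionality. intros J.
  apply lowerX_eq; [now apply upperX_bdd|].
  assert (HfY : bdd (Ysp A) (fun M => f (Ysp_Xsp M))) by (destruct Hf as [c Hc]; exists c; auto).
  destruct (ext_spec _ J HfY) as [H1 H2]. split.
  - intros z [K [HK ->]]. destruct (Xsp_below_Ysp A K) as [M HM].
    apply Rle_trans with (f (Ysp_Xsp M)).
    + apply H1. exists M. auto.
    + apply (upperX_spec f K Hf). exists (Ysp_Xsp M). auto.
  - intros b Hb. apply H2. intros z [M [HM ->]].
    replace (f (Ysp_Xsp M)) with (upperX f (Ysp_Xsp M)).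
    + apply Hb. exists (Ysp_Xsp M). auto.
    + apply upperX_eq; auto. split.
      * intros z [K [HK ->]]. simpl in HK. rewrite (Xsp_above_Ysp M K HK). lra.
      * intros b' Hb'. apply Hb'. exists (Ysp_Xsp M). auto.
Qed.

Lemma bdd_Ysp f : bdd (Xsp A) f -> bdd (Ysp A) (fun M => f (Ysp_Xsp M)).
Proof. intros [c Hc]. exists c. auto. Qed.

Lemma normalX_ext f : normalX f -> f = ext (fun M => f (Ysp_Xsp M)).
Proof. intros [Hf E]. rewrite E at 1. now apply normX_ext. Qed.

Lemma ext_normalX g : bdd (Ysp A) g -> normalX (ext g).
Proof.
  intros Hg. assert (H := ext_bdd g Hg). split; auto.
  change (lowerX (upperX (ext g))) with (normX (ext g)). rewrite normX_ext; auto.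
  f_equal. apply functional_extensionality. intros M. now rewrite ext_Ysp.
Qed.

Lemma normX_Ysp f M : bdd (Xsp A) f -> normX f (Ysp_Xsp M) = f (Ysp_Xsp M).
Proof. intros Hf. now rewrite normX_ext, ext_Ysp. Qed.

End Normalization.

Lemma bddD T f g : bdd T f -> bdd T g -> bdd T (fun I => f I + g I).
Proof.
  intros [c Hc] [d Hd]. exists (c + d). intros I.
  eapply Rle_trans; [apply Rabs_triang|]. specialize (Hc I); specialize (Hd I). lra.
Qed.

Lemma bddM T f g : bdd T f -> bdd T g -> bdd T (fun I => f I * g I).
Proof.
  intros [c Hc] [d Hd]. exists (c * d). intros I. rewrite Rabs_mult.
  apply Rmult_le_compat; auto using Rabs_pos.
Qed.

Lemma bddZ T r f : bdd T f -> bdd T (fun I => r * f I).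
Proof. intros. apply bddM; auto. exists (Rabs r). intros; lra. Qed.

Lemma zetaA_bdd (A : ballg) (a : A) : bdd (Ysp A) (zetaA a).
Proof.
  destruct (bounded_both A a) as [C [_ [H1 H2]]]. exists C. intros M.
  apply (zetaA_le A _ _ M) in H1, H2. rewrite zetaA_opp in H2. rewrite zetaA_cst in H1, H2.
  apply Rabs_le. lra.
Qed.

Lemma restriction_iso (A : ballg) : @iso_NB A (fun f M => f (Ysp_Xsp M)).
Proof.
  unfold iso_NB. split; [|split; [|split; [|split; [|split; [|split; [|split]]]]]].
  - intros f [Hf _]. now apply bdd_Ysp.
  - intros g Hg. exists (ext A g). split; [now apply ext_normalX|].
    apply functional_extensionality. intros M. apply ext_Ysp.
  - intros f g Hf Hg E. rewrite (normalX_ext A f Hf), (normalX_ext A g Hg). now rewrite E.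
  - intros f g [Hf _] [Hg _]. apply functional_extensionality. intros M.
    apply (normX_Ysp A (fun I => f I + g I)). now apply bddD.
  - intros f g [Hf _] [Hg _]. apply functional_extensionality. intros M.
    apply (normX_Ysp A (fun I => f I * g I)). now apply bddM.
  - intros r f [Hf _]. apply functional_extensionality. intros M.
    apply (normX_Ysp A (fun I => r * f I)). now apply bddZ.
  - reflexivity.
  - intros f g Hf Hg. split; [auto|]. intros H.
    rewrite (normalX_ext A f), (normalX_ext A g) by auto.
    apply ext_le; auto; apply bdd_Ysp; [apply Hf | apply Hg].
Qed.

(** The join is an archimedean l-ideal, and it is everything unless some maximal l-ideal contains
    both [J] and [I]. This matches [U_] with the infimum defining [ext]. *)
Lemma U_iff (A : ballg) (I : Arch A) (J : Xsp A) :
  U_ I J <-> forall M : Ysp A, proj1_sig J ⊆ proj1_sig M -> ~ proj1_sig I ⊆ proj1_sig M.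
Proof.
  split.
  - intros H M HJ HI. destruct (Ysp_proper A M) as [a Ha]. apply Ha.
    apply (H a); auto. apply Ysp_arch.
  - intros H. apply NNPP. intros Hn. apply not_all_ex_not in Hn.
    destruct (lideal_in_maximal A (archjoin (proj1_sig J) (proj1_sig I))) as [M HM]; auto.
    + apply arch_lideal_join.
    + apply (archjoin_subset_iff A _ _ _ (Ysp_arch A M)) in HM. now apply (H M).
Qed.

Lemma ext_chi (A : ballg) (I : Arch A) :
  ext A (chi (fun M => ~ proj1_sig I ⊆ proj1_sig M)) = chi (U_ I).
Proof.
  apply functional_extensionality. intros J.
  assert (Hge : forall M : Ysp A, 0 <= chi (fun M => ~ proj1_sig I ⊆ proj1_sig M) M)
    by (intros M; unfold chi; destruct excluded_middle_informative; lra).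
  apply Rinf_eq. destruct (classic (U_ I J)) as [H | H].
  - rewrite chi_true by auto. rewrite U_iff in H. split.
    + intros z [M [HM ->]]. rewrite chi_true by auto. lra.
    + intros b Hb. destruct (Xsp_below_Ysp A J) as [M HM].
      apply Hb. exists M. split; auto. rewrite chi_true; auto.
  - rewrite chi_false by auto. rewrite U_iff in H. split.
    + intros z [M [HM ->]]. apply Hge.
    + intros b Hb. apply not_all_ex_not in H. destruct H as [M HM].
      apply imply_to_and in HM. destruct HM as [HM HI]. apply Hb.
      exists M. split; auto. rewrite chi_false; auto.
Qed.

(** * Existence of [phi], and [alpha] and [gamma] for an arbitrary [phi] *)

Section MainTheorem.
Variables (A : ballg) (B : boolalg) (e : Arch A -> B) (RB : ralg) (x : B -> RB).
Variables (D : ballg) (j : RB -> D).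
Hypothesis He : free_bool_ext e.
Hypothesis Hx : is_RB x.
Hypothesis Hj : dedekind_completion j.

Lemma phi_exists : exists phi : D -> Xsp A -> R,
  iso_DN phi /\ forall I : Arch A, phi (j (x (e I))) = chi (U_ I).
Proof.
  set (cf := coeff A B e RB x D j).
  assert (Hb : forall d, bdd (Ysp A) (cf d)) by (intros; apply coeff_bdd; auto).
  assert (HX : forall d, bdd (Xsp A) (ext A (cf d))) by auto using ext_bdd.
  exists (fun d => ext A (cf d)). split;
    [split; [|split; [|split; [|split; [|split; [|split; [|split]]]]]]|].
  - intros d. now apply ext_normalX.
  - intros f Hf. destruct (coeff_onto A B e RB x D j He Hx Hj (fun M => f (Ysp_Xsp M))) as [d Hd].
    + apply bdd_Ysp, Hf.
    + exists d. rewrite (normalX_ext A f Hf). f_equal. now apply functional_extensionality.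
  - intros d1 d2 E.
    assert (E1 : forall M, cf d1 M = cf d2 M)
      by (intros M; rewrite <- (ext_Ysp A (cf d1)), E; apply ext_Ysp).
    apply ble_anti; apply (coeff_le A B e RB x D j He Hx Hj); intros M; fold cf; rewrite E1; lra.
  - intros d1 d2. rewrite normX_ext by now apply bddD. f_equal.
    apply functional_extensionality. intros M. rewrite !ext_Ysp. now apply coeffD.
  - intros d1 d2. rewrite normX_ext by now apply bddM. f_equal.
    apply functional_extensionality. intros M. rewrite !ext_Ysp. now apply coeffM.
  - intros r d. rewrite normX_ext by now apply bddZ. f_equal.
    apply functional_extensionality. intros M. rewrite !ext_Ysp. now apply coeffZ.
  - apply functional_extensionality. intros J.
    assert (E : forall M, cf 1%A M = 1) by (intros M; rewrite <- rcst1; now apply coeffC).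
    apply Rinf_eq. split.
    + intros z [M [_ ->]]. rewrite E. lra.
    + intros b H. destruct (Xsp_below_Ysp A J) as [M HM]. apply H. exists M. now rewrite E.
  - intros d1 d2. rewrite (ext_le A _ _ (Hb d1) (Hb d2)). now apply coeff_le.
  - intros I. rewrite <- ext_chi. f_equal. apply functional_extensionality. intros M.
    unfold cf. rewrite coeff_j by auto. now apply tau_e.
Qed.

Variable phi : D -> Xsp A -> R.
Hypothesis Hphi : iso_DN phi.
Hypothesis Hphi_e : forall I : Arch A, phi (j (x (e I))) = chi (U_ I).

Add Ring D_ring : (ralg_ring D).
Add Ring A_ring : (ralg_ring A).

(** Coordinates read from the given [phi] rather than from [coeff], so that what follows holds for
    every isomorphism with the prescribed values. *)
Definition phiY (d : D) (M : Ysp A) : R := phi d (Ysp_Xsp M).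

Lemma phi_normal d : isN (Xsp A) (@openX A) (phi d).
Proof. apply Hphi. Qed.

Lemma phi_ext d : phi d = ext A (phiY d).
Proof. apply normalX_ext, phi_normal. Qed.

Lemma phiY_bdd d : bdd (Ysp A) (phiY d).
Proof. apply bdd_Ysp, phi_normal. Qed.

Lemma phiY_add d d' M : phiY (d + d')%A M = phiY d M + phiY d' M.
Proof.
  unfold phiY. rewrite (proj1 (proj2 (proj2 (proj2 Hphi)))).
  apply (normX_Ysp A (fun I => phi d I + phi d' I)). apply bddD; apply phi_normal.
Qed.

Lemma phiY_scal r d M : phiY (rscal r d) M = r * phiY d M.
Proof.
  unfold phiY. rewrite (proj1 (proj2 (proj2 (proj2 (proj2 (proj2 Hphi)))))).
  apply (normX_Ysp A (fun I => r * phi d I)). apply bddZ, phi_normal.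
Qed.

Lemma phiY_one M : phiY 1%A M = 1.
Proof. unfold phiY. now rewrite (proj1 (proj2 (proj2 (proj2 (proj2 (proj2 (proj2 Hphi))))))). Qed.

Lemma phiY_cst r M : phiY (rcst r) M = r.
Proof. unfold rcst. rewrite phiY_scal, phiY_one. ring. Qed.

Lemma phiY_le d d' : (d <= d')%A <-> forall M, phiY d M <= phiY d' M.
Proof.
  rewrite (proj2 (proj2 (proj2 (proj2 (proj2 (proj2 (proj2 Hphi))))))).
  rewrite (phi_ext d), (phi_ext d'). apply ext_le; apply phiY_bdd.
Qed.

Lemma phiY_onto g : bdd (Ysp A) g -> exists d, forall M, phiY d M = g M.
Proof.
  intros Hg. destruct (proj1 (proj2 Hphi) (ext A g)) as [d Hd]; [now apply ext_normalX|].
  exists d. intros M. unfold phiY. rewrite Hd. apply ext_Ysp.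
Qed.

Lemma phiY_e I M : phiY (j (x (e I))) M = chi (fun M => ~ proj1_sig I ⊆ proj1_sig M) M.
Proof. unfold phiY. now rewrite Hphi_e, <- ext_chi, ext_Ysp. Qed.

Lemma phiY_scal_bc r I M : phiY (j (rscal r (x (bc (e I))))) M =
  r * (1 - chi (fun M => ~ proj1_sig I ⊆ proj1_sig M) M).
Proof.
  rewrite (x_bc B RB x Hx), (jZ RB D j Hj), (jB RB D j Hj), (j1 RB D j Hj).
  unfold rsub. rewrite phiY_scal, phiY_add, roppE, phiY_scal, phiY_one, phiY_e. ring.
Qed.

(* The supremum is attained at [M] by the pair [I = M], [r = zetaA (a + s) M]. *)
Lemma alpha_lub a s l : (0 <= a + rcst s)%A -> (forall M, phiY l M = zetaA a M + s) ->
  is_lubD (fun y => exists (r : R) (I : Arch A),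
                 proj1_sig I (bneg (rsub (radd a (rcst s)) (rcst r))) /\
                 y = j (rscal r (x (bc (e I))))) l.
Proof.
  intros Hs Hl. split.
  - intros y [r [I [HI ->]]]. apply phiY_le. intros M. rewrite phiY_scal_bc, Hl.
    destruct (classic (proj1_sig I ⊆ proj1_sig M)) as [H | H].
    + rewrite chi_false by auto. apply H in HI. apply Ysp_neg in HI.
      rewrite zetaA_sub, zetaA_add, !zetaA_cst in HI. lra.
    (* Here the term vanishes at [M], and it stays below the claimed supremum only because
       [a + s >= 0]; this is the purpose of the shift. *)
    + rewrite chi_true by auto. apply (zetaA_ge0 A _ M) in Hs.
      rewrite zetaA_add, zetaA_cst in Hs. lra.
  - intros u Hu. apply phiY_le. intros M. rewrite Hl.
    specialize (Hu (j (rscal (zetaA a M + s) (x (bc (e (Ysp_Arch M))))))).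
    assert (H : (j (rscal (zetaA a M + s) (x (bc (e (Ysp_Arch M))))) <= u)%A).
    { apply Hu. exists (zetaA a M + s), (Ysp_Arch M). split; auto.
      apply (Ysp_neg A). rewrite zetaA_sub, zetaA_add, !zetaA_cst. lra. }
    rewrite phiY_le in H. specialize (H M). rewrite phiY_scal_bc, chi_false in H.
    + lra.
    + simpl. auto.
Qed.

Lemma alpha_exists a : exists d : D, alpha_rel e x j a d.
Proof.
  destruct (phiY_onto (zetaA a) (zetaA_bdd A a)) as [d Hd].
  destruct (bounded_both A a) as [C [_ [_ HC]]].
  assert (HC' : (0 <= a + rcst C)%A).
  { apply sub_ge0 in HC. now replace (a + rcst C)%A with (rcst C - - a)%A by ring. }
  exists d, C. split; auto. apply alpha_lub; auto. intros M.
  now rewrite phiY_add, phiY_cst, Hd.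
Qed.

(** An element with coordinates [zetaA a + s] is a supremum of the same set, and suprema are unique.
    The value is thus independent of the [s] hidden in [alpha_rel]. *)
Lemma alpha_phiY a d : alpha_rel e x j a d -> forall M, phiY d M = zetaA a M.
Proof.
  intros [s [Hs [Hub Hlub]]].
  destruct (phiY_onto (zetaA a) (zetaA_bdd A a)) as [d0 Hd0].
  assert (Hl0 : forall M, phiY (d0 + rcst s)%A M = zetaA a M + s)
    by (intros M; now rewrite phiY_add, phiY_cst, Hd0).
  destruct (alpha_lub a s _ Hs Hl0) as [Hub0 Hlub0].
  assert (E : (d + rcst s = d0 + rcst s)%A) by (apply ble_anti; auto).
  intros M. rewrite <- Hd0. assert (E1 := f_equal (fun d => phiY d M) E). simpl in E1.
  rewrite !phiY_add in E1. lra.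
Qed.

Lemma gamma_formula a d : alpha_rel e x j a d -> forall J : Xsp A,
  is_lub (fun r => proj1_sig J (bneg (rsub a (rcst r)))) (phi d J).
Proof.
  intros Ha J. rewrite phi_ext. assert (E := alpha_phiY a d Ha).
  destruct (ext_spec A (phiY d) J (phiY_bdd d)) as [H1 H2]. split.
  - intros r Hr. apply H2. intros z [M [HM ->]]. apply HM in Hr. apply Ysp_neg in Hr.
    rewrite zetaA_sub, zetaA_cst in Hr. rewrite E. lra.
  - intros b Hb. apply Hb.
    (* The supremum is attained: membership in [J] is tested at the maximal l-ideals above [J],
       where the infimum is by definition a lower bound of the values of [a]. *)
    apply (arch_lideal_subset A (fun c => c = bneg (a - rcst (ext A (phiY d) J))%A) (proj1_sig J)); auto.
    + apply (proj2_sig J).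
    + intros M HM c Hc. rewrite Hc. apply Ysp_neg. rewrite zetaA_sub, zetaA_cst, <- E.
      assert (ext A (phiY d) J <= phiY d M); [|lra]. apply H1. exists M. auto.
Qed.

End MainTheorem.

Theorem mainTheorem14
  (A : ballg) (B : boolalg) (e : Arch A -> B) (He : free_bool_ext e)
  (RB : ralg) (x : B -> RB) (Hx : is_RB x)
  (D : ballg) (j : RB -> D) (Hj : dedekind_completion j) :
  (* Y_A is a subset of X *)
  (exists incl : Ysp A -> Xsp A, forall M, proj1_sig (incl M) = proj1_sig M) /\
  (* the isomorphism phi : D(R[B]) -> N(X) with phi(x_I) = chi_{U_I} exists *)
  (exists phi : D -> Xsp A -> R,
      iso_DN phi /\ forall I : Arch A, phi (j (x (e I))) = chi (U_ I)) /\
  (* alpha : A -> D(R[B]) is well defined *)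
  (forall a : A, exists d : D, alpha_rel e x j a d) /\
  forall (incl : Ysp A -> Xsp A), (forall M, proj1_sig (incl M) = proj1_sig M) ->
  forall phi : D -> Xsp A -> R,
    iso_DN phi -> (forall I : Arch A, phi (j (x (e I))) = chi (U_ I)) ->
    let psi := fun (f : Xsp A -> R) (M : Ysp A) => f (incl M) in
    iso_NB psi /\
    (forall I : Arch A,
        psi (phi (j (x (e I)))) =
        chi (fun M : Ysp A => ~ (forall a, proj1_sig I a -> proj1_sig M a))) /\
    (forall (a : A) (d : D), alpha_rel e x j a d ->
        (* gamma(a) = phi(alpha(a)) *)
        psi (phi d) = zetaA a /\
        forall J : Xsp A,
          is_lub (fun r => proj1_sig J (bneg (rsub a (rcst r)))) (phi d J)).
Proof.
  assert (Hex := phi_exists A B e RB x D j He Hx Hj).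
  split; [|split; [|split]].
  - now exists Ysp_Xsp.
  - exact Hex.
  - destruct Hex as [phi [Hphi Hphi_e]]. now apply (alpha_exists A B e RB x D j Hx Hj phi).
  - intros incl Hincl phi Hphi Hphi_e psi.
    (* Points of [Xsp A] are determined by their underlying predicates, so the inclusion is
       unique. *)
    assert (E : incl = Ysp_Xsp).
    { apply functional_extensionality. intros M. apply sig_ext. intros a.
      rewrite Hincl. reflexivity. }
    unfold psi. rewrite E. split; [apply restriction_iso|]. split.
    + intros I. apply functional_extensionality. intros M.
      now apply (phiY_e A B e RB x D j phi).
    + intros a d Ha. split.
      * apply functional_extensionality. intros M.
        now apply (alpha_phiY A B e RB x D j Hx Hj phi Hphi Hphi_e).
      * now apply (gamma_formula A B e RB x D j Hx Hj phi).
Qed.
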